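(* Let $\mathcal G$ be a subcategory of the category of commutative rings which is closed under the formation of forcing algebras. Suppose that an admissible $\mathcal G$-persistent closure operation $N\mapsto N^{c}$ is given, defined for submodules in a certain category $\mathcal M$ of finitely presented modules. Then for every $R\in\mathcal G$ there exists an affine single-handed Grothendieck topology on $X=\operatorname{Spec} R$ such that the induced closure operation satisfies $N^{\mathrm{top-cl}}=N^{c}$, and such that the homomorphisms $R\to S$ in $\mathcal G$ yield site morphisms $(\operatorname{Spec} S)_{\mathrm{top}}\to(\operatorname{Spec} R)_{\mathrm{top}}$.
   Context: Setting: for every $R\in\mathcal G$ a subcategory $\mathcal M_R$ of (here: finitely presented) $R$-modules is given such that $M\otimes_R S\in\mathcal M_S$ for $M\in\mathcal M_R$ and $R\to S$ in $\mathcal G$. A closure operation on $\mathcal M$ assigns to submodules $N\subseteq M$ in $\mathcal M_R$ a submodule $N^c\subseteq M$ with $N\subseteq N^c=(N^c)^c$. Forcing algebra: let $N\subseteq M$ be $R$-modules with $M/N$ finitely presented, $s\in M$. Choose a presentation $R^{\nu}\xrightarrow{D}R^{\mu}\to M/N\to 0$ and a lift $\tilde s\in R^\mu$ of the class of $s$. The forcing algebra for $(M,N,s)$ is $B=R[T_1,\dots,T_\nu]/(DT-\tilde s)$. It is $c$-admissible if $s\in N^c$. That $\mathcal G$ is closed under forming forcing algebras means that for $R\in\mathcal G$ such a forcing algebra $R\to B$ is in $\mathcal G$. A ring homomorphism $R\to A$ is $c$-pure if for all $U\subseteq V$ in $\mathcal M_R$ and $z\in V$: $z\otimes1\in\operatorname{im}(U\otimes_RA\to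 V\otimes_RA)$ implies $z\in U^c$. The closure operation is $\mathcal G$-persistent if for $R\to S$ in $\mathcal G$ the image of $N^c$ in $M\otimes_RS$ lies in $(N')^c$, where $N'=\operatorname{im}(N\otimes_RS\to M\otimes_RS)$. It is ($\mathcal G$-)admissible if it is a closure operation, every $c$-admissible forcing algebra is $c$-pure, and it is $\mathcal G$-persistent. Grothendieck topology on a scheme $X$: a category $\mathcal T_X$ of schemes over $X$ (with certain $X$-morphisms), containing $X$ and closed under fibre products of schemes, with a collection of coverings (families $U_i\to U$ in $\mathcal T_X$) such that isomorphisms are coverings and coverings are stable under composition and base change. It is affine if all structural morphisms $U\to X$ are affine, and single-handed if all its morphisms are of finite type and every covering consists of a single morphism. $R\to S$ yields a site morphism if base change along $\operatorname{Spec} S\to\operatorname{Spec} R$ sends objects to objects and coverings to coverings. Induced closure: for $X=\operatorname{Spec} R$ and an $R$-module $M$ let $M_{\mathrm{top}}$ be the sheafification of $\operatorname{Spec} S\mapsto M\otimes_R S$ on $\mathcal T_X$, with sheafification map $\theta:M\to\Gamma(X_{\mathrm{top}},M_{\mathrm{top}})$. For $N\subseteq M$ let $N^{\mathrm{top}}$ be the image sheaf of $N_{\mathrm{top}}\to M_{\mathrm{top}}$; then $N^{\mathrm{top-cl}}:=\theta^{-1}(\Gamma(X_{\mathrm{top}},N^{\mathrm{top}}))$.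
   Formalization: The category of modules is additionally assumed to be closed under isomorphism and finite direct sums; without direct sums the claim fails, e.g. for modules with at most two generators over algebras of finite type over k[x1,x2,x3]/(x1,x2,x3)^2. *)

(* Defs.v *)
From HB Require Import structures.
From mathcomp Require Import all_boot all_algebra.
From mathcomp Require Import boolp.

Set Implicit Arguments.
Unset Strict Implicit.
Unset Printing Implicit Defensive.

Import GRing.Theory.
Local Open Scope ring_scope.
Local Open Scope quotient_scope.

(* Rings are [comPzRingType]s: a forcing algebra or a fibre product of affine
   schemes may be the zero ring.  Polynomial rings and quotient rings in
   MathComp are restricted to nonzero rings, so finitely generated algebras are
   presented here by polynomial expressions modulo a congruence. *)

Section PropQuotient.
Variables (T : choiceType) (r : T -> T -> Prop).
Hypotheses (r_refl : forall x, r x x) (r_sym : forall x y, r x y -> r y x).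
Hypothesis r_trans : forall x y z, r x y -> r y z -> r x z.

Lemma prop_equiv_class : equiv_class_of (fun x y => `[< r x y >]).
Proof.
split=> [x|x y|y x z]; first exact/asboolP.
  by apply/asboolP/asboolP => /r_sym.
by move=> /asboolP xy /asboolP yz; apply/asboolP/(r_trans xy).
Qed.

End PropQuotient.

Inductive pexp (R : Type) (n : nat) : Type :=
  | PCst of R
  | PVar of 'I_n
  | PAdd of pexp R n & pexp R n
  | POpp of pexp R n
  | PMul of pexp R n & pexp R n.
Arguments PCst {R n}.
Arguments PVar {R n}.

HB.instance Definition _ (R : Type) (n : nat) := gen_eqMixin (pexp R n).
HB.instance Definition _ (R : Type) (n : nat) := gen_choiceMixin (pexp R n).

Fixpoint peval (R B : comPzRingType) (n : nat) (f : {rmorphism R -> B})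
    (b : 'I_n -> B) (p : pexp R n) : B :=
  match p with
  | PCst r => f r
  | PVar i => b i
  | PAdd p q => peval f b p + peval f b q
  | POpp p => - peval f b p
  | PMul p q => peval f b p * peval f b q
  end.

Definition finite_type (A B : comPzRingType) (f : {rmorphism A -> B}) : Prop :=
  exists (n : nat) (b : 'I_n -> B), forall y : B, exists p, peval f b p = y.

Section PresentedAlgebra.
Variables (R : comPzRingType) (n : nat) (E : pexp R n -> pexp R n -> Prop).

Inductive pcong : pexp R n -> pexp R n -> Prop :=
  | pcong_rel p q : E p q -> pcong p q
  | pcong_refl p : pcong p p
  | pcong_sym p q : pcong p q -> pcong q p
  | pcong_trans p q r : pcong p q -> pcong q r -> pcong p r
  | pcong_add p p' q q' :
      pcong p p' -> pcong q q' -> pcong (PAdd p q) (PAdd p' q')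
  | pcong_opp p p' : pcong p p' -> pcong (POpp p) (POpp p')
  | pcong_mul p p' q q' :
      pcong p p' -> pcong q q' -> pcong (PMul p q) (PMul p' q')
  | pcong_addA p q r : pcong (PAdd p (PAdd q r)) (PAdd (PAdd p q) r)
  | pcong_addC p q : pcong (PAdd p q) (PAdd q p)
  | pcong_add0 p : pcong (PAdd (PCst 0) p) p
  | pcong_addN p : pcong (PAdd (POpp p) p) (PCst 0)
  | pcong_mulA p q r : pcong (PMul p (PMul q r)) (PMul (PMul p q) r)
  | pcong_mulC p q : pcong (PMul p q) (PMul q p)
  | pcong_mul1 p : pcong (PMul (PCst 1) p) p
  | pcong_mulD p q r :
      pcong (PMul (PAdd p q) r) (PAdd (PMul p r) (PMul q r))
  | pcong_cstD a b : pcong (PCst (a + b)) (PAdd (PCst a) (PCst b))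
  | pcong_cstM a b : pcong (PCst (a * b)) (PMul (PCst a) (PCst b)).

Definition pcongb : rel (pexp R n) := fun p q => `[< pcong p q >].

Canonical pcong_equiv : equiv_rel (pexp R n) := @EquivRelPack _ pcongb
  (prop_equiv_class pcong_refl pcong_sym pcong_trans).
Canonical pcong_encModRel := defaultEncModRel pcongb.

(* R[T_0, ..., T_(n-1)] / (p - q | E p q) *)
Definition palg := {eq_quot pcongb}.
HB.instance Definition _ := Choice.on palg.

Lemma palg_eq p q : pcong p q -> \pi_palg p = \pi_palg q.
Proof. by move=> pq; apply/eqmodP/asboolP. Qed.

Lemma palg_repr p : pcong (repr (\pi_palg p)) p.
Proof. by have /eqmodP/asboolP := reprK (\pi_palg p). Qed.

Definition palg_add (x y : palg) := \pi_palg (PAdd (repr x) (repr y)).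
Definition palg_opp (x : palg) := \pi_palg (POpp (repr x)).
Definition palg_mul (x y : palg) := \pi_palg (PMul (repr x) (repr y)).

Lemma palg_addE p q : palg_add (\pi_palg p) (\pi_palg q) = \pi_palg (PAdd p q).
Proof. by apply: palg_eq; apply: pcong_add; apply: palg_repr. Qed.
Lemma palg_oppE p : palg_opp (\pi_palg p) = \pi_palg (POpp p).
Proof. by apply: palg_eq; apply: pcong_opp; apply: palg_repr. Qed.
Lemma palg_mulE p q : palg_mul (\pi_palg p) (\pi_palg q) = \pi_palg (PMul p q).
Proof. by apply: palg_eq; apply: pcong_mul; apply: palg_repr. Qed.

Lemma palg_addA : associative palg_add.
Proof.
elim/quotW=> x; elim/quotW=> y; elim/quotW=> z.
rewrite (palg_addE y z) (palg_addE x) (palg_addE x y) palg_addE.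
by apply: palg_eq; apply: pcong_addA.
Qed.
Lemma palg_addC : commutative palg_add.
Proof.
move=> x y; rewrite -[x]reprK -[y]reprK !palg_addE.
by apply: palg_eq; apply: pcong_addC.
Qed.
Lemma palg_add0 : left_id (\pi_palg (PCst 0)) palg_add.
Proof.
by move=> x; rewrite -[x]reprK palg_addE; apply: palg_eq; apply: pcong_add0.
Qed.
Lemma palg_addN : left_inverse (\pi_palg (PCst 0)) palg_opp palg_add.
Proof.
move=> x; rewrite -[x]reprK palg_oppE palg_addE.
by apply: palg_eq; apply: pcong_addN.
Qed.

HB.instance Definition _ :=
  GRing.isZmodule.Build palg palg_addA palg_addC palg_add0 palg_addN.

Lemma palg_mulA : associative palg_mul.
Proof.
elim/quotW=> x; elim/quotW=> y; elim/quotW=> z.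
rewrite (palg_mulE y z) (palg_mulE x) (palg_mulE x y) palg_mulE.
by apply: palg_eq; apply: pcong_mulA.
Qed.
Lemma palg_mulC : commutative palg_mul.
Proof.
move=> x y; rewrite -[x]reprK -[y]reprK !palg_mulE.
by apply: palg_eq; apply: pcong_mulC.
Qed.
Lemma palg_mul1 : left_id (\pi_palg (PCst 1)) palg_mul.
Proof.
by move=> x; rewrite -[x]reprK palg_mulE; apply: palg_eq; apply: pcong_mul1.
Qed.
Lemma palg_mulD : left_distributive palg_mul palg_add.
Proof.
elim/quotW=> x; elim/quotW=> y; elim/quotW=> z.
rewrite (palg_addE x y) (palg_mulE x z) (palg_mulE y z) palg_mulE palg_addE.
by apply: palg_eq; apply: pcong_mulD.
Qed.

HB.instance Definition _ := GRing.Zmodule_isComPzRing.Build palg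
  palg_mulA palg_mulC palg_mul1 palg_mulD.

Definition palg_cst (a : R) : palg := \pi_palg (PCst a).

Lemma palg_cst_additive : zmod_morphism palg_cst.
Proof.
have cstD a b : palg_cst (a + b) = palg_cst a + palg_cst b.
  rewrite /palg_cst [RHS]palg_addE.
  by apply: palg_eq; apply: pcong_cstD.
by move=> a b; apply: (canRL (addrK _)); rewrite -cstD subrK.
Qed.

Lemma palg_cst_monoid : monoid_morphism palg_cst.
Proof.
split=> // a b; rewrite /palg_cst [RHS]palg_mulE.
by apply: palg_eq; apply: pcong_cstM.
Qed.

HB.instance Definition _ :=
  GRing.isZmodMorphism.Build R palg palg_cst palg_cst_additive.
HB.instance Definition _ :=
  GRing.isMonoidMorphism.Build R palg palg_cst palg_cst_monoid.

Definition palg_str : {rmorphism R -> palg} := palg_cst.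

End PresentedAlgebra.

Inductive texp (M S : Type) : Type :=
  | TZero
  | TPure of M & S
  | TAdd of texp M S & texp M S
  | TOpp of texp M S.
Arguments TZero {M S}.

HB.instance Definition _ (M S : Type) := gen_eqMixin (texp M S).
HB.instance Definition _ (M S : Type) := gen_choiceMixin (texp M S).

Fixpoint texp_map (M S M' S' : Type) (g : M -> M') (h : S -> S')
    (p : texp M S) : texp M' S' :=
  match p with
  | TZero => TZero
  | TPure m s => TPure (g m) (h s)
  | TAdd p q => TAdd (texp_map g h p) (texp_map g h q)
  | TOpp p => TOpp (texp_map g h p)
  end.

Section BaseChange.
Variables (R S : comPzRingType) (phi : {rmorphism R -> S}) (M : lmodType R).

Inductive tcong : texp M S -> texp M S -> Prop :=
  | tcong_refl p : tcong p p
  | tcong_sym p q : tcong p q -> tcong q p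
  | tcong_trans p q r : tcong p q -> tcong q r -> tcong p r
  | tcong_add p p' q q' :
      tcong p p' -> tcong q q' -> tcong (TAdd p q) (TAdd p' q')
  | tcong_opp p p' : tcong p p' -> tcong (TOpp p) (TOpp p')
  | tcong_addA p q r : tcong (TAdd p (TAdd q r)) (TAdd (TAdd p q) r)
  | tcong_addC p q : tcong (TAdd p q) (TAdd q p)
  | tcong_add0 p : tcong (TAdd TZero p) p
  | tcong_addN p : tcong (TAdd (TOpp p) p) TZero
  | tcong_pureDl m m' s :
      tcong (TPure (m + m') s) (TAdd (TPure m s) (TPure m' s))
  | tcong_pureDr m s s' :
      tcong (TPure m (s + s')) (TAdd (TPure m s) (TPure m s'))
  | tcong_pureZ a m s : tcong (TPure (a *: m) s) (TPure m (phi a * s)).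

Definition tcongb : rel (texp M S) := fun p q => `[< tcong p q >].

Canonical tcong_equiv : equiv_rel (texp M S) := @EquivRelPack _ tcongb
  (prop_equiv_class tcong_refl tcong_sym tcong_trans).
Canonical tcong_encModRel := defaultEncModRel tcongb.

(* M (x)_R S, as an S-module *)
Definition tens := {eq_quot tcongb}.
HB.instance Definition _ := Choice.on tens.

Definition pure (m : M) (s : S) : tens := \pi_tens (TPure m s).

Lemma tens_eq p q : tcong p q -> \pi_tens p = \pi_tens q.
Proof. by move=> pq; apply/eqmodP/asboolP. Qed.

Lemma tens_repr p : tcong (repr (\pi_tens p)) p.
Proof. by have /eqmodP/asboolP := reprK (\pi_tens p). Qed.

Definition tens_add (x y : tens) := \pi_tens (TAdd (repr x) (repr y)).
Definition tens_opp (x : tens) := \pi_tens (TOpp (repr x)).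
Definition tens_scale (t : S) (x : tens) :=
  \pi_tens (texp_map idfun ( *%R t) (repr x)).

Lemma tens_addE p q : tens_add (\pi_tens p) (\pi_tens q) = \pi_tens (TAdd p q).
Proof. by apply: tens_eq; apply: tcong_add; apply: tens_repr. Qed.
Lemma tens_oppE p : tens_opp (\pi_tens p) = \pi_tens (TOpp p).
Proof. by apply: tens_eq; apply: tcong_opp; apply: tens_repr. Qed.

Lemma tens_addA : associative tens_add.
Proof.
elim/quotW=> x; elim/quotW=> y; elim/quotW=> z.
rewrite (tens_addE y z) (tens_addE x) (tens_addE x y) tens_addE.
by apply: tens_eq; apply: tcong_addA.
Qed.
Lemma tens_addC : commutative tens_add.
Proof.
move=> x y; rewrite -[x]reprK -[y]reprK !tens_addE.
by apply: tens_eq; apply: tcong_addC.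
Qed.
Lemma tens_add0 : left_id (\pi_tens TZero) tens_add.
Proof.
by move=> x; rewrite -[x]reprK tens_addE; apply: tens_eq; apply: tcong_add0.
Qed.
Lemma tens_addN : left_inverse (\pi_tens TZero) tens_opp tens_add.
Proof.
move=> x; rewrite -[x]reprK tens_oppE tens_addE.
by apply: tens_eq; apply: tcong_addN.
Qed.

HB.instance Definition _ :=
  GRing.isZmodule.Build tens tens_addA tens_addC tens_add0 tens_addN.

Lemma pi_tensD p q :
  \pi_tens (TAdd p q) = (\pi_tens p : tens) + (\pi_tens q : tens).
Proof. by rewrite [RHS]tens_addE. Qed.
Lemma pi_tensN p : \pi_tens (TOpp p) = - (\pi_tens p : tens).
Proof. by rewrite [RHS]tens_oppE. Qed.
Lemma pi_tens0 : \pi_tens TZero = (0 : tens).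
Proof. by []. Qed.

Lemma pureDl m m' s : pure (m + m') s = pure m s + pure m' s.
Proof. by rewrite -pi_tensD; apply: tens_eq; apply: tcong_pureDl. Qed.
Lemma pureDr m s s' : pure m (s + s') = pure m s + pure m s'.
Proof. by rewrite -pi_tensD; apply: tens_eq; apply: tcong_pureDr. Qed.
Lemma pureZ a m s : pure (a *: m) s = pure m (phi a * s).
Proof. by apply: tens_eq; apply: tcong_pureZ. Qed.

Lemma tens_scale_cong t p q : tcong p q ->
  tcong (texp_map idfun ( *%R t) p) (texp_map idfun ( *%R t) q).
Proof.
elim=> {p q} /=; try by constructor.
- by move=> p q r _ pq _ qr; apply: (tcong_trans pq qr).
- by move=> m s s'; rewrite mulrDr; apply: tcong_pureDr.
- by move=> a m s; rewrite mulrCA; apply: tcong_pureZ.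
Qed.

Lemma tens_scaleE t p :
  tens_scale t (\pi_tens p) = \pi_tens (texp_map idfun ( *%R t) p).
Proof. by apply: tens_eq; apply: tens_scale_cong; apply: tens_repr. Qed.

Lemma tens_scaleA a b x :
  tens_scale a (tens_scale b x) = tens_scale (a * b) x.
Proof.
elim/quotW: x => p.
rewrite (tens_scaleE b) (tens_scaleE a) tens_scaleE; congr (\pi_tens _).
by elim: p => //= [m s|p -> q ->|p ->] //; rewrite mulrA.
Qed.
Lemma tens_scale1 : left_id 1 tens_scale.
Proof.
elim/quotW=> p; rewrite tens_scaleE; congr (\pi_tens _).
by elim: p => //= [m s|p -> q ->|p ->] //; rewrite mul1r.
Qed.
Lemma tens_scaleDr : right_distributive tens_scale +%R.
Proof.
move=> a; elim/quotW=> p; elim/quotW=> q.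
by rewrite -pi_tensD (tens_scaleE a p) (tens_scaleE a q) tens_scaleE -pi_tensD.
Qed.
Lemma tens_scaleDl (x : tens) :
  {morph (fun a => tens_scale a x : tens) : a b / a + b}.
Proof.
move=> a b; elim/quotW: x => p.
rewrite (tens_scaleE a) (tens_scaleE b) tens_scaleE.
elim: p => //= [|m s|p IHp q IHq|p IHp].
- by rewrite pi_tens0 addr0.
- by rewrite mulrDl; apply: pureDr.
- by rewrite !pi_tensD IHp IHq addrACA.
- by rewrite !pi_tensN IHp opprD.
Qed.

HB.instance Definition _ := GRing.Zmodule_isLmodule.Build S tens
  tens_scaleA tens_scale1 tens_scaleDr tens_scaleDl.

Lemma scale_pure t m s : t *: pure m s = pure m (t * s).
Proof. exact: tens_scaleE. Qed.

End BaseChange.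

(* m (x) s |-> g m (x) h s; meaningful for g linear and h compatible with the
   structure maps, see [tens_mapE] *)
Definition tens_map (R S S' : comPzRingType) (phi : {rmorphism R -> S})
    (phi' : {rmorphism R -> S'}) (M M' : lmodType R)
    (g : {linear M -> M'}) (h : {rmorphism S -> S'})
    (x : tens phi M) : tens phi' M' :=
  \pi_(tens phi' M') (texp_map g h (repr x)).

Section TensMap.
Variables (R S S' : comPzRingType) (phi : {rmorphism R -> S}).
Variables (phi' : {rmorphism R -> S'}) (M M' : lmodType R).
Variables (g : {linear M -> M'}) (h : {rmorphism S -> S'}).
Hypothesis hphi : forall r, h (phi r) = phi' r.

Lemma texp_map_cong p q : tcong phi p q ->
  tcong phi' (texp_map g h p) (texp_map g h q).
Proof.
elim=> {p q} /=; try by constructor.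
- by move=> p q r _ pq _ qr; apply: (tcong_trans pq qr).
- by move=> m m' s; rewrite linearD; apply: tcong_pureDl.
- by move=> m s s'; rewrite rmorphD; apply: tcong_pureDr.
- by move=> a m s; rewrite linearZ rmorphM hphi; apply: tcong_pureZ.
Qed.

Lemma tens_mapE p : tens_map phi' g h (\pi_(tens phi M) p) =
  \pi_(tens phi' M') (texp_map g h p).
Proof. by apply: tens_eq; apply: texp_map_cong; apply: tens_repr. Qed.

Lemma tens_map_pure m s :
  tens_map phi' g h (pure phi m s) = pure phi' (g m) (h s).
Proof. exact: tens_mapE. Qed.

Lemma tens_mapD : {morph @tens_map _ _ _ phi phi' _ _ g h : x y / x + y}.
Proof.
move=> x y; rewrite -[x]reprK -[y]reprK -pi_tensD !tens_mapE /=.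
exact: pi_tensD.
Qed.

Lemma tens_mapZ a x :
  tens_map phi' g h (a *: x : tens phi M) = h a *: tens_map phi' g h x.
Proof.
rewrite -[x]reprK [a *: _]tens_scaleE !tens_mapE [RHS]tens_scaleE.
congr (\pi_(tens phi' M') _).
by elim: (repr x) => //= [m s|p -> q ->|p ->] //; rewrite rmorphM.
Qed.

End TensMap.

Section Submodules.
Variables (R : comPzRingType) (M : lmodType R).

Definition sub_mod (N : submodClosed M) := {x : M | x \in N}.

Section SubMod.
Variable N : submodClosed M.
HB.instance Definition _ := SubChoice.on (sub_mod N).
HB.instance Definition _ := [SubChoice_isSubLmodule of sub_mod N by <:].
Definition sub_incl : {linear sub_mod N -> M} := val.
End SubMod.

Variables (S : comPzRingType) (phi : {rmorphism R -> S}) (N : submodClosed M).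

Definition im_base_pred : pred (tens phi M) := fun x =>
  `[< exists w : tens phi (sub_mod N), tens_map phi (sub_incl N) idfun w = x >].

Lemma im_base_closed : submod_closed im_base_pred.
Proof.
have ok r : idfun (phi r) = phi r by [].
split=> [|a x y /asboolP[u <-] /asboolP[v <-]]; apply/asboolP.
  exists (\pi_(tens phi (sub_mod N)) TZero).
  exact: (tens_mapE (sub_incl N) ok).
by exists (a *: u + v); rewrite tens_mapD // tens_mapZ.
Qed.

(* N' = im (N (x)_R S -> M (x)_R S) *)
Definition im_base : submodClosed (tens phi M) :=
  HB.pack im_base_pred
    (GRing.isSubmodClosed.Build S (tens phi M) im_base_pred im_base_closed).

End Submodules.

Section Presentations.
Variable R : comPzRingType.

(* R^nu --D--> R^mu --p--> Q --> 0 is exact *)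
Definition is_presentation (mu nu : nat) (D : 'M[R]_(mu, nu)) (Q : lmodType R)
    (p : {linear 'cV[R]_mu -> Q}) : Prop :=
  (forall y : Q, exists v, p v = y) /\
  (forall v, p v = 0 <-> exists w : 'cV[R]_nu, v = D *m w).

Definition finitely_presented (Q : lmodType R) : Prop :=
  exists (mu nu : nat) (D : 'M[R]_(mu, nu)) (p : {linear 'cV[R]_mu -> Q}),
    is_presentation D p.

(* q exhibits Q as the quotient M / N *)
Definition is_quotient (M Q : lmodType R) (N : submodClosed M)
    (q : {linear M -> Q}) : Prop :=
  (forall y : Q, exists m, q m = y) /\ (forall m, q m = 0 <-> m \in N).

Variables (mu nu : nat) (D : 'M[R]_(mu, nu)) (t : 'cV[R]_mu).

Definition forcing_rel (p q : pexp R nu) : Prop :=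
  exists i : 'I_mu,
    p = \big[@PAdd R nu/PCst 0]_(j < nu) PMul (PCst (D i j)) (PVar j) /\
    q = PCst (t i 0).

(* R[T_1, ..., T_nu] / (D T - t), with its structure map *)
Definition forcing_alg : comPzRingType := palg forcing_rel.
Definition forcing_str : {rmorphism R -> forcing_alg} := palg_str forcing_rel.

(* (D, t) are data from which a forcing algebra for (M, N, s) is formed *)
Definition forcing_data (M : lmodType R) (N : submodClosed M) (s : M) : Prop :=
  exists (Q : lmodType R) (q : {linear M -> Q}) (p : {linear 'cV[R]_mu -> Q}),
    [/\ is_quotient N q, is_presentation D p & p t = q s].

End Presentations.

Record ring_subcat := RingSubcat {
  rc_ob : comPzRingType -> Prop;
  rc_hom : forall R S : comPzRingType, {rmorphism R -> S} -> Prop;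
  rc_hom_ob : forall (R S : comPzRingType) (f : {rmorphism R -> S}),
    rc_hom f -> rc_ob R /\ rc_ob S;
  rc_id : forall (R : comPzRingType) (f : {rmorphism R -> R}),
    rc_ob R -> f =1 id -> rc_hom f;
  rc_comp : forall (R S T : comPzRingType) (f : {rmorphism R -> S})
      (g : {rmorphism S -> T}) (h : {rmorphism R -> T}),
    rc_hom f -> rc_hom g -> h =1 g \o f -> rc_hom h
}.

(* M / N is finitely presented as soon as there are forcing data. *)
Definition closed_under_forcing (G : ring_subcat) : Prop :=
  forall (R : comPzRingType) (M : lmodType R) (N : submodClosed M) (s : M)
    (mu nu : nat) (D : 'M[R]_(mu, nu)) (t : 'cV[R]_mu),
    rc_ob G R -> forcing_data D t N s -> rc_hom G (forcing_str D t).

Definition mod_class := forall R : comPzRingType, lmodType R -> Prop.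

Section ModClass.
Variables (G : ring_subcat) (MM : mod_class).

Definition base_change_stable : Prop :=
  forall (R S : comPzRingType) (phi : {rmorphism R -> S}) (M : lmodType R),
    rc_hom G phi -> MM M -> MM (tens phi M : lmodType S).

Definition replete : Prop :=
  forall (R : comPzRingType) (M M' : lmodType R) (f : {linear M -> M'}),
    rc_ob G R -> bijective f -> MM M -> MM M'.

Definition consists_of_finitely_presented : Prop :=
  forall (R : comPzRingType) (M : lmodType R),
    rc_ob G R -> MM M -> finitely_presented M.

(* MM as an additive subcategory.  Without sums the closures attached to two
   modules need not be induced by one topology: forcing algebras for them are
   c-pure separately, but their tensor product, a covering by base change and
   composition, need not be. *)
Definition closed_under_sums : Prop :=
  forall (R : comPzRingType) (M M' : lmodType R),
    rc_ob G R -> MM M -> MM M' -> MM (M * M' : lmodType R)%type.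

(* "N \subseteq M in MM" *)
Definition sub_in (R : comPzRingType) (M : lmodType R) (N : submodClosed M) :=
  MM M /\ MM (sub_mod N : lmodType R).

(* The operation is total; only its values on the pairs N \subseteq M in MM
   are constrained or used. *)
Definition sub_op := forall (R : comPzRingType) (M : lmodType R),
  submodClosed M -> submodClosed M.

Variable c : sub_op.

Definition is_closure : Prop :=
  forall (R : comPzRingType) (M : lmodType R) (N : submodClosed M),
    rc_ob G R -> sub_in N -> {subset N <= c N} /\ c (c N) =i c N.

Definition cpure (R A : comPzRingType) (phi : {rmorphism R -> A}) : Prop :=
  forall (V : lmodType R) (U : submodClosed V) (z : V),
    sub_in U -> pure phi z 1 \in im_base phi U -> z \in c U.

Definition admissible_forcing_pure : Prop :=
  forall (R : comPzRingType) (M : lmodType R) (N : submodClosed M) (s : M)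
    (mu nu : nat) (D : 'M[R]_(mu, nu)) (t : 'cV[R]_mu),
    rc_ob G R -> sub_in N -> forcing_data D t N s -> s \in c N ->
    cpure (forcing_str D t).

(* For the closure of N' to be defined, N' has to belong to MM. *)
Definition persistent : Prop :=
  forall (R S : comPzRingType) (phi : {rmorphism R -> S}) (M : lmodType R)
    (N : submodClosed M),
    rc_hom G phi -> sub_in N ->
    sub_in (im_base phi N) /\
    (forall s, s \in c N -> pure phi s 1 \in c (im_base phi N)).

Definition admissible : Prop :=
  [/\ is_closure, admissible_forcing_pure & persistent].

End ModClass.

(* Schemes affine over X = Spec R are R-algebras; an X-morphism
   Spec B -> Spec A is a morphism of R-algebras A -> B. *)
Record alg (R : comPzRingType) := Alg {
  alg_ring :> comPzRingType;
  alg_str : {rmorphism R -> alg_ring}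
}.

Definition alg_hom (R : comPzRingType) (A B : alg R) (f : {rmorphism A -> B}) :=
  forall r, f (alg_str A r) = alg_str B r.

Definition base_alg (R : comPzRingType) : alg R :=
  Alg (idfun : {rmorphism R -> R}).

(* Spec P is the fibre product of Spec B and Spec C over Spec A *)
Definition is_pushout (A B C P : comPzRingType)
    (f : {rmorphism A -> B}) (g : {rmorphism A -> C})
    (i : {rmorphism B -> P}) (j : {rmorphism C -> P}) : Prop :=
  i \o f =1 j \o g /\
  forall (D : comPzRingType) (h : {rmorphism B -> D}) (k : {rmorphism C -> D}),
    h \o f =1 k \o g ->
    exists u : {rmorphism P -> D}, [/\ u \o i =1 h, u \o j =1 k &
      forall u' : {rmorphism P -> D},
        u' \o i =1 h -> u' \o j =1 k -> u' =1 u].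

(* An affine Grothendieck topology on Spec R all of whose coverings consist of
   a single morphism; arrows are written on the side of rings. *)
Record affine_topology (R : comPzRingType) := AffineTopology {
  ob : alg R -> Prop;
  hom : forall A B : alg R, {rmorphism A -> B} -> Prop;
  cov : forall A B : alg R, {rmorphism A -> B} -> Prop;
  hom_alg : forall (A B : alg R) (f : {rmorphism A -> B}),
    hom f -> [/\ ob A, ob B & alg_hom f];
  hom_id : forall (A : alg R) (f : {rmorphism A -> A}),
    ob A -> f =1 id -> hom f;
  hom_comp : forall (A B C : alg R) (f : {rmorphism A -> B})
      (g : {rmorphism B -> C}) (h : {rmorphism A -> C}),
    hom f -> hom g -> h =1 g \o f -> hom h;
  ob_base : ob (base_alg R);
  (* fibre products of schemes belong to the category, with their projections,
     and are fibre products there *)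
  hom_fibre : forall (A B C P : alg R) (f : {rmorphism A -> B})
      (g : {rmorphism A -> C}) (i : {rmorphism B -> P})
      (j : {rmorphism C -> P}),
    hom f -> hom g -> alg_hom i -> is_pushout f g i j -> hom i /\ hom j;
  hom_mediating : forall (A B C P D : alg R) (f : {rmorphism A -> B})
      (g : {rmorphism A -> C}) (i : {rmorphism B -> P})
      (j : {rmorphism C -> P}) (u : {rmorphism P -> D})
      (h : {rmorphism B -> D}) (k : {rmorphism C -> D}),
    hom f -> hom g -> alg_hom i -> is_pushout f g i j ->
    hom h -> hom k -> u \o i =1 h -> u \o j =1 k -> hom u;
  cov_hom : forall (A B : alg R) (f : {rmorphism A -> B}), cov f -> hom f;
  cov_iso : forall (A B : alg R) (f : {rmorphism A -> B})
      (g : {rmorphism B -> A}),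
    hom f -> hom g -> cancel f g -> cancel g f -> cov f;
  cov_comp : forall (A B C : alg R) (f : {rmorphism A -> B})
      (g : {rmorphism B -> C}) (h : {rmorphism A -> C}),
    cov f -> cov g -> h =1 g \o f -> cov h;
  cov_base : forall (A B C P : alg R) (f : {rmorphism A -> B})
      (g : {rmorphism A -> C}) (i : {rmorphism B -> P})
      (j : {rmorphism C -> P}),
    cov f -> hom g -> alg_hom i -> is_pushout f g i j -> cov j
}.

Definition single_handed (R : comPzRingType) (X : affine_topology R) : Prop :=
  forall (A B : alg R) (f : {rmorphism A -> B}), hom X f -> finite_type f.

(* Base change along phi : R -> S is a morphism of sites
   (Spec S, Y) -> (Spec R, X). *)
Definition site_morphism (R S : comPzRingType) (phi : {rmorphism R -> S})
    (X : affine_topology R) (Y : affine_topology S) : Prop :=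
  (forall (A : alg R) (A' : alg S) (a : {rmorphism A -> A'}),
     ob X A -> is_pushout phi (alg_str A) (alg_str A') a -> ob Y A') /\
  (forall (A B : alg R) (A' B' : alg S) (a : {rmorphism A -> A'})
      (b : {rmorphism B -> B'}) (f : {rmorphism A -> B})
      (f' : {rmorphism A' -> B'}),
     is_pushout phi (alg_str A) (alg_str A') a ->
     is_pushout phi (alg_str B) (alg_str B') b ->
     alg_hom f' -> f' \o a =1 b \o f ->
     (hom X f -> hom Y f') /\ (cov X f -> cov Y f')).

Section Sheaves.
Variables (R : comPzRingType) (X : affine_topology R).

Record obj := Obj { obj_alg :> alg R; obj_ob : ob X obj_alg }.
Record mor (A B : obj) := Mor {
  mor_fun :> {rmorphism A -> B};
  mor_hom : hom X mor_fun
}.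

Definition base_obj : obj := Obj (ob_base X).

(* Presheaves of sets: sheafification and image sheaves of presheaves of
   modules are computed on the underlying presheaves of sets. *)
Record presheaf := Presheaf {
  sec :> obj -> Type;
  res : forall A B : obj, mor A B -> sec A -> sec B;
  res_id : forall (A : obj) (f : mor A A) (x : sec A), f =1 id -> res f x = x;
  res_comp : forall (A B C : obj) (f : mor A B) (g : mor B C) (h : mor A C)
      (x : sec A),
    h =1 g \o f -> res h x = res g (res f x)
}.

Record psh_map (F F' : presheaf) := PshMap {
  psh_fun :> forall A : obj, F A -> F' A;
  psh_nat : forall (A B : obj) (f : mor A B) (x : F A),
    psh_fun (res f x) = res f (psh_fun x)
}.

Definition is_sheaf (F : presheaf) : Prop :=
  forall (A B P : obj) (f : mor A B) (i j : mor B P),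
    cov X f -> is_pushout f f i j ->
    forall x : F B, res i x = res j x -> exists! y : F A, res f y = x.

Definition is_sheafification (F F' : presheaf) (theta : psh_map F F') : Prop :=
  is_sheaf F' /\
  forall (H : presheaf) (eta : psh_map F H), is_sheaf H ->
    exists u : psh_map F' H,
      (forall (A : obj) (x : F A), u A (theta A x) = eta A x) /\
      (forall u' : psh_map F' H,
         (forall (A : obj) (x : F A), u' A (theta A x) = eta A x) ->
         forall (A : obj) (y : F' A), u' A y = u A y).

(* sections over A of the image sheaf of k : F -> F' *)
Definition image_sheaf (F F' : presheaf) (k : psh_map F F') (A : obj)
    (y : F' A) : Prop :=
  exists (B : obj) (f : mor A B), cov X f /\ exists x : F B, k B x = res f y.

Lemma mor_alg (A B : obj) (f : mor A B) : alg_hom f.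
Proof. by case: (hom_alg (mor_hom f)). Qed.

Definition mod_res (M : lmodType R) (A B : obj) (f : mor A B) :
    tens (alg_str A) M -> tens (alg_str B) M :=
  tens_map (alg_str B) (idfun : {linear M -> M}) f.

Lemma mod_res_id (M : lmodType R) (A : obj) (f : mor A A)
  (x : tens (alg_str A) M) : f =1 id -> mod_res f x = x.
Proof.
move=> f1; elim/quotW: x => p; rewrite /mod_res (tens_mapE _ (mor_alg f)).
congr (\pi_(tens _ M) _).
by elim: p => //= [m s|p -> q ->|p ->] //; rewrite f1.
Qed.

Lemma mod_res_comp (M : lmodType R) (A B C : obj) (f : mor A B) (g : mor B C)
    (h : mor A C) (x : tens (alg_str A) M) :
  h =1 g \o f -> mod_res h x = mod_res g (mod_res f x).
Proof.
move=> hE; elim/quotW: x => p; rewrite /mod_res.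
rewrite (tens_mapE _ (mor_alg f)) (tens_mapE _ (mor_alg g)).
rewrite (tens_mapE _ (mor_alg h)); congr (\pi_(tens _ M) _).
by elim: p => //= [m s|p -> q ->|p ->] //; rewrite hE.
Qed.

(* Spec S |-> M (x)_R S *)
Definition mod_presheaf (M : lmodType R) : presheaf :=
  Presheaf (@mod_res_id M) (@mod_res_comp M).

(* s \in N^top-cl.  Sheafifications are unique up to a unique isomorphism, so
   the choice of N_top and M_top is immaterial; k is the map N_top -> M_top
   induced by the inclusion N -> M. *)
Definition top_closure (M : lmodType R) (N : submodClosed M) (s : M) : Prop :=
  exists (Mtop Ntop : presheaf) (thetaM : psh_map (mod_presheaf M) Mtop)
    (thetaN : psh_map (mod_presheaf (sub_mod N)) Ntop) (k : psh_map Ntop Mtop),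
    [/\ is_sheafification thetaM, is_sheafification thetaN,
        forall (A : obj) (x : tens (alg_str A) (sub_mod N)),
          k A (thetaN A x) =
          thetaM A (tens_map (alg_str A) (sub_incl N) idfun x) &
        image_sheaf k (thetaM base_obj (pure (alg_str base_obj) s 1))].

End Sheaves.

(* Main.v *)
Require Import Defs.
From HB Require Import structures.
From mathcomp Require Import all_boot all_algebra.
From mathcomp Require Import boolp.

(* Every covering is an isomorphism or, up to isomorphism, the base change to an
   object of finite type of one forcing algebra R -> R[T]/(DT - t) coming from
   some s in N^c.  This class is stable under base change; along R -> S in G
   this is persistence, because the base change of the forcing algebra of
   (M, N, s) is a forcing algebra of (M (x) S, N', s (x) 1).  It is stable under
   composition because the tensor product of the forcing algebras of (M, N, s)
   and (M', N', s') is a forcing algebra of (M + M', N + N', (s, s')), and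
   (s, s') is in (N + N')^c since purity makes c functorial.

   Unwinding sheafification, s is in N^top-cl iff s (x) 1 lies in N' over some
   covering of Spec R.  The forcing algebra of s is such a covering when s is in
   N^c; conversely coverings of Spec R are c-pure. *)

Set Implicit Arguments.
Unset Strict Implicit.
Unset Printing Implicit Defensive.

Import GRing.Theory.
Local Open Scope ring_scope.

(** Every covering A -> B is recorded by a linear system DT = t with coefficients in R, not in A.
    Purity is therefore invoked only for forcing algebras over R, and persistence only along maps R
    -> S in G, while the objects of the site may be arbitrary R-algebras of finite type. The choice
    also drives composition: the system of a second covering B -> C already has coefficients in R,
    hence in A, so the two systems are solved side by side over A. Fibre products are known only up
    to isomorphism, and the axioms of a topology quantify over all of them. Forcing algebras are
    accordingly handled as representing objects: A-algebra maps B -> E are the solutions of the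
    system in E. Base change and composition become statements about solutions. A topology is closed
    under those fibre products that exist but does not supply them. Sheafification needs them along
    coverings; there they are built as forcing algebras of the transported system. *)

Lemma pure0r (R S : comPzRingType) (phi : {rmorphism R -> S}) (M : lmodType R)
    (m : M) :
  pure phi m 0 = 0.
Proof. by apply: (addrI (pure phi m 0)); rewrite -pureDr !addr0. Qed.

Lemma pureNr (R S : comPzRingType) (phi : {rmorphism R -> S}) (M : lmodType R)
    (m : M) s :
  pure phi m (- s) = - pure phi m s.
Proof. by apply: (addIr (pure phi m s)); rewrite -pureDr !addNr pure0r. Qed.

(** Negation gets no case of its own: [P x] and [P (- x)] are carried together through the induction
    on a representing expression, and the negative of a pure tensor is again pure. *)
Lemma tens_ind (R S : comPzRingType) (phi : {rmorphism R -> S}) (M : lmodType R)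
    (P : tens phi M -> Prop) :
  P 0 -> (forall m s, P (pure phi m s)) ->
  (forall x y, P x -> P y -> P (x + y)) -> forall x, P x.
Proof.
move=> P0 Ppure PD x; suff: P x /\ P (- x) by case.
rewrite -[x]reprK.
elim: (repr x) => {x} [|m s|p [Pp PNp] q [Pq PNq]|p [Pp PNp]].
- by rewrite pi_tens0 oppr0.
- by split; [exact: Ppure | rewrite -pureNr].
- by rewrite pi_tensD opprD; split; apply: PD.
- by rewrite pi_tensN opprK.
Qed.

Lemma tens_map0 (R S S' : comPzRingType) (phi : {rmorphism R -> S})
    (phi' : {rmorphism R -> S'}) (M M' : lmodType R) (g : {linear M -> M'})
    (h : {rmorphism S -> S'}) :
  (forall r, h (phi r) = phi' r) -> tens_map phi' g h (0 : tens phi M) = 0.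
Proof. by move=> hphi; apply: (tens_mapE g hphi TZero). Qed.

(** * Sheafification *)

Section Sheafification.
Variables (R : comPzRingType) (X : affine_topology R).

Definition mor_id (A : obj X) : mor A A :=
  Mor (@hom_id _ X A idfun (obj_ob A) (frefl _)).

Definition mor_comp (A B C : obj X) (f : mor A B) (g : mor B C) : mor A C :=
  Mor (hom_comp (mor_hom f) (mor_hom g)
         (frefl ((g : {rmorphism B -> C}) \o (f : {rmorphism A -> B})))).

Definition psh_comp (F F' F'' : presheaf X) (k : psh_map F F')
    (l : psh_map F' F'') : psh_map F F'' :=
  PshMap (fun A B f x =>
    etrans (congr1 (l B) (psh_nat k f x)) (psh_nat l f (k A x))).

Lemma cov_mor_id (A : obj X) : cov X (mor_id A).
Proof. exact: (cov_iso (mor_hom (mor_id A)) (mor_hom (mor_id A))). Qed.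

Lemma cov_mor_comp (A B C : obj X) (f : mor A B) (g : mor B C) :
  cov X f -> cov X g -> cov X (mor_comp f g).
Proof. by move=> cf cg; apply: (cov_comp cf cg). Qed.

(** [is_sheaf] tests only those fibre products that exist, so for a covering without one the sheaf
    condition would be empty. Existence is therefore a separate hypothesis of the sheaf theory
    below. *)
Definition has_cov_pushouts : Prop :=
  forall (A B C : obj X) (f : mor A B) (g : mor A C), cov X f ->
    exists (P : obj X) (i : mor B P) (j : mor C P), is_pushout f g i j.

Hypothesis pushouts : has_cov_pushouts.

Lemma cov_refine (A B C : obj X) (f : mor A B) (g : mor A C) : cov X f ->
  exists (P : obj X) (i : mor B P) (j : mor C P), cov X j /\ i \o f =1 j \o g.
Proof.
move=> cf; have [P [i [j ij]]] := pushouts g cf.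
exists P, i, j; split; last by case: ij.
exact: cov_base cf (mor_hom g) (mor_alg i) ij.
Qed.

Section Presheaf.
Variable F : presheaf X.

Lemma res_mor_comp (A B C : obj X) (f : mor A B) (g : mor B C) (x : F A) :
  res (mor_comp f g) x = res g (res f x).
Proof. exact: res_comp. Qed.

Lemma res_ext (A B : obj X) (f g : mor A B) (x : F A) :
  f =1 g -> res f x = res g x.
Proof.
move=> fg; rewrite (@res_comp _ _ F _ _ _ g (mor_id B) f) //.
by rewrite (res_id (f := mor_id B)).
Qed.

Lemma res_square (A B C D : obj X) (f : mor A B) (g : mor A C) (i : mor B D)
    (j : mor C D) (x : F A) :
  i \o f =1 j \o g -> res i (res f x) = res j (res g x).
Proof. by move=> ij; rewrite -!res_mor_comp; apply: res_ext. Qed.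

(** This is the equality imposed by sheafification: see [sheafification_inj] and [sheaf_sep]. *)
Definition loceq (A : obj X) (x y : F A) : Prop :=
  exists (B : obj X) (f : mor A B), cov X f /\ res f x = res f y.

Lemma loceq_refl (A : obj X) (x : F A) : loceq x x.
Proof. by exists A, (mor_id A); split=> //; apply: cov_mor_id. Qed.

Lemma loceq_sym (A : obj X) (x y : F A) : loceq x y -> loceq y x.
Proof. by move=> [B [f [cf e]]]; exists B, f. Qed.

Lemma loceq_trans (A : obj X) (x y z : F A) :
  loceq x y -> loceq y z -> loceq x z.
Proof.
move=> [B [f [cf xy]]] [C [g [cg yz]]].
have [P [i [j [cj ij]]]] := cov_refine g cf.
exists P, (mor_comp g j); split; first exact: cov_mor_comp.
by rewrite !res_mor_comp -yz -(res_square x ij) xy (res_square y ij).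
Qed.

Lemma loceq_res (A B : obj X) (f : mor A B) (x y : F A) :
  loceq x y -> loceq (res f x) (res f y).
Proof.
move=> [C [g [cg xy]]]; have [P [i [j [cj ij]]]] := cov_refine f cg.
by exists P, j; split=> //; rewrite -!(res_square _ ij) xy.
Qed.

Lemma loceq_local (A B : obj X) (f : mor A B) (x y : F A) :
  cov X f -> loceq (res f x) (res f y) -> loceq x y.
Proof.
move=> cf [C [g [cg e]]]; exists C, (mor_comp f g).
by split; [exact: cov_mor_comp | rewrite !res_mor_comp].
Qed.

(** The common restriction is a matching family, so it has a unique descent, and both sections are
    descents of it. A pushout is required to put the sheaf condition to use. *)
Lemma sheaf_sep (A : obj X) (x y : F A) : is_sheaf F -> loceq x y -> x = y.
Proof.
move=> shF [B [f [cf xy]]]; have [P [i [j ij]]] := pushouts f cf.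
have [|z [_ zU]] := shF _ _ _ f i j cf ij (res f x).
  by apply: res_square; case: ij.
by rewrite -(zU x) // -(zU y).
Qed.

End Presheaf.

Section Sheafify.
Variable F : presheaf X.

(* A section of the sheafification over A is encoded, without quotients, as
   the relation "y, restricted to B, is the image of x" between f : A -> B and
   x in F B. *)
Record shsec (A : obj X) := ShSec {
  shrel :> forall B : obj X, mor A B -> F B -> Prop;
  shrel_res : forall (B C : obj X) (f : mor A B) (g : mor B C)
      (h : mor A C) x,
    h =1 g \o f -> shrel f x -> shrel h (res g x);
  shrel_eq : forall (B : obj X) (f : mor A B) x y,
    shrel f x -> shrel f y -> loceq x y;
  shrel_local : forall (B C : obj X) (f : mor A B) (g : mor B C)
      (h : mor A C) x,
    cov X g -> h =1 g \o f -> shrel h (res g x) -> shrel f x;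
  shrel_ex : exists (B : obj X) (f : mor A B) x, cov X f /\ shrel f x
}.

Lemma shrel_ext (A : obj X) (s : shsec A) (B : obj X) (f g : mor A B) x :
  f =1 g -> s B f x -> s B g x.
Proof.
move=> fg fx; rewrite -(res_id (f := mor_id B) x) //.
by apply: shrel_res fx => y; rewrite -fg.
Qed.

(** Extensionality replaces a quotient: the closure conditions saturate the relation, so a section
    has only one encoding. *)
Lemma shsecP (A : obj X) (s s' : shsec A) :
  (forall B (f : mor A B) x, s B f x <-> s' B f x) -> s = s'.
Proof.
case: s s' => [r a b c d] [r' a' b' c' d'] /= rr'.
have e : r = r'.
  apply: functional_extensionality_dep => B; apply/funext=> f; apply/funext=> x.
  exact/propext.
subst r'; congr ShSec; exact: Prop_irrelevance.
Qed.

Section Restriction.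
Variables (A A' : obj X) (a : mor A A') (s : shsec A).

Definition shres_rel (B : obj X) (f : mor A' B) : F B -> Prop :=
  s B (mor_comp a f).

Lemma shres_res (B C : obj X) (f : mor A' B) (g : mor B C) (h : mor A' C) x :
  h =1 g \o f -> shres_rel f x -> shres_rel h (res g x).
Proof. by move=> hE; apply: shrel_res => y; rewrite /= hE. Qed.

Lemma shres_eq (B : obj X) (f : mor A' B) x y :
  shres_rel f x -> shres_rel f y -> loceq x y.
Proof. exact: shrel_eq. Qed.

Lemma shres_local (B C : obj X) (f : mor A' B) (g : mor B C) (h : mor A' C) x :
  cov X g -> h =1 g \o f -> shres_rel h (res g x) -> shres_rel f x.
Proof. by move=> cg hE; apply: shrel_local => // y; rewrite /= hE. Qed.

Lemma shres_ex :
  exists (B : obj X) (f : mor A' B) x, cov X f /\ shres_rel f x.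
Proof.
have [B [f [x [cf fx]]]] := shrel_ex s.
have [P [i [j [cj ij]]]] := cov_refine a cf.
exists P, j, (res i x); split=> //.
by apply: shrel_res fx => y; exact: esym (ij y).
Qed.

Definition shres : shsec A' := ShSec shres_res shres_eq shres_local shres_ex.

End Restriction.

Lemma shres_id (A : obj X) (f : mor A A) (s : shsec A) :
  f =1 id -> shres f s = s.
Proof.
move=> f1; apply: shsecP => B g x; rewrite /= /shres_rel.
by split; apply: shrel_ext => y; rewrite /= f1.
Qed.

Lemma shres_comp (A B C : obj X) (f : mor A B) (g : mor B C) (h : mor A C)
    (s : shsec A) :
  h =1 g \o f -> shres h s = shres g (shres f s).
Proof.
move=> hE; apply: shsecP => D k x; rewrite /= /shres_rel /= /shres_rel.
by split; apply: shrel_ext => y; rewrite /= hE.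
Qed.

Definition shpsh : presheaf X := Presheaf shres_id shres_comp.

Section Unit.
Variables (A : obj X) (x : F A).

Definition shunit_rel (B : obj X) (f : mor A B) (y : F B) := loceq (res f x) y.

Lemma shunit_res (B C : obj X) (f : mor A B) (g : mor B C) (h : mor A C) y :
  h =1 g \o f -> shunit_rel f y -> shunit_rel h (res g y).
Proof. by move=> /res_comp; rewrite /shunit_rel => ->; apply: loceq_res. Qed.

Lemma shunit_eq (B : obj X) (f : mor A B) y z :
  shunit_rel f y -> shunit_rel f z -> loceq y z.
Proof. by move=> /loceq_sym; apply: loceq_trans. Qed.

Lemma shunit_local (B C : obj X) (f : mor A B) (g : mor B C) (h : mor A C) y :
  cov X g -> h =1 g \o f -> shunit_rel h (res g y) -> shunit_rel f y.
Proof.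
by move=> cg /res_comp; rewrite /shunit_rel => ->; apply: loceq_local.
Qed.

Lemma shunit_ex : exists (B : obj X) (f : mor A B) y, cov X f /\ shunit_rel f y.
Proof.
exists A, (mor_id A), (res (mor_id A) x).
by split; [exact: cov_mor_id | exact: loceq_refl].
Qed.

Definition shunit : shpsh A :=
  ShSec shunit_res shunit_eq shunit_local shunit_ex.

End Unit.

Lemma shunit_nat (A B : obj X) (f : mor A B) (x : F A) :
  shunit (res f x) = res f (shunit x).
Proof.
by apply: shsecP => C g y; rewrite /= /shres_rel /= /shunit_rel res_mor_comp.
Qed.

Definition sh_theta : psh_map F shpsh := PshMap shunit_nat.

(** Together with [shrel_ex] this says that every section comes locally from [F]. It yields
    uniqueness of maps out of [shpsh] and local surjectivity. *)
Lemma shres_unit (A B : obj X) (s : shsec A) (f : mor A B) x :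
  s B f x -> shres f s = shunit x.
Proof.
move=> fx; apply: shsecP => C g y; rewrite /= /shres_rel /shunit_rel.
have gx : s C (mor_comp f g) (res g x) by apply: shrel_res fx.
split=> [|[D [h [ch e]]]]; first exact: shrel_eq.
apply: (shrel_local (g := h) (h := mor_comp (mor_comp f g) h)) => //.
by rewrite -e; apply: shrel_res gx.
Qed.

Lemma sh_sep (A B : obj X) (f : mor A B) (s s' : shsec A) :
  cov X f -> shres f s = shres f s' -> s = s'.
Proof.
move=> cf ss'; apply: shsecP.
have half (t t' : shsec A) : shres f t = shres f t' ->
    forall C (g : mor A C) x, t C g x -> t' C g x.
  move=> tt' C g x gx; have [P [i [j [cj ij]]]] := cov_refine g cf.
  apply: (shrel_local (g := j) (h := mor_comp f i)) => //.
  have : shrel (shres f t) i (res j x) by apply: shrel_res gx.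
  by rewrite tt'.
by move=> C g x; split; apply: half.
Qed.

Section Glue.
Variables (A B P : obj X) (f : mor A B) (i j : mor B P).
Hypotheses (cf : cov X f) (ij : is_pushout f f i j).
Variable s : shsec B.
Hypothesis s_ij : shres i s = shres j s.

(** Two maps that agree after [f] factor together through the pushout [P], by a map that
    [hom_mediating] places in the site. The matching condition [s_ij] then identifies the two
    restrictions of [s]. *)
Lemma glue_indep (C : obj X) (l l' : mor B C) x :
  l \o f =1 l' \o f -> s C l x -> s C l' x.
Proof.
move=> ll' lx; have [u [ui uj _]] := ij.2 _ _ _ ll'.
have uh : Defs.hom X u.
  exact: hom_mediating (mor_hom f) (mor_hom f) (mor_alg i) ij (mor_hom l)
    (mor_hom l') ui uj.
have : shrel (shres i s) (Mor uh) x.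
  apply: (shrel_ext (g := mor_comp i (Mor uh)) _ lx) => y.
  exact: esym (ui y).
rewrite s_ij => jx.
exact: (shrel_ext (f := mor_comp j (Mor uh)) _ jx).
Qed.

(** Quantifying over all commutative squares avoids choosing a fibre product of [f] and [g]. The
    condition is not vacuous, since [cov_refine] provides a square in which [k] is a covering. *)
Definition glue_rel (C : obj X) (g : mor A C) (x : F C) : Prop :=
  forall (D : obj X) (k : mor C D) (l : mor B D),
    k \o g =1 l \o f -> s D l (res k x).

Lemma glue_res (C D : obj X) (g : mor A C) (k : mor C D) (h : mor A D) x :
  h =1 k \o g -> glue_rel g x -> glue_rel h (res k x).
Proof.
move=> hE gx E k' l e; rewrite -res_mor_comp; apply: gx => y.
by rewrite /= -[RHS]e /= hE.
Qed.

Lemma glue_eq (C : obj X) (g : mor A C) x y :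
  glue_rel g x -> glue_rel g y -> loceq x y.
Proof.
have [Q [l [k [ck kl]]]] := cov_refine g cf.
move=> gx gy; apply: (loceq_local ck).
by apply: (@shrel_eq _ s _ l); [apply: gx | apply: gy] => z; rewrite kl.
Qed.

Lemma glue_local (C D : obj X) (g : mor A C) (k : mor C D) (h : mor A D) x :
  cov X k -> h =1 k \o g -> glue_rel h (res k x) -> glue_rel g x.
Proof.
(* The hypothesis speaks only of squares that factor through [k]. Refining [k] along [e] produces
   such a square over a covering of [E], and locality of [s] brings the conclusion back to [E]. *)
move=> ck hE hx E e l el; have [Q [e' [k' [ck' ek]]]] := cov_refine e ck.
apply: (shrel_local (g := k') (h := mor_comp l k')) => //.
rewrite -(res_square x ek); apply: hx => z.
rewrite /= hE; have /= -> := ek (g z); congr (k' _); exact: el.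
Qed.

Lemma glue_of (C : obj X) (b : mor B C) x :
  s C b x -> glue_rel (mor_comp f b) x.
Proof.
move=> bx D k l kl; apply: (@glue_indep _ (mor_comp b k)) => //.
exact: shrel_res bx.
Qed.

Lemma glue_ex : exists (C : obj X) (g : mor A C) x, cov X g /\ glue_rel g x.
Proof.
have [C [b [x [cb bx]]]] := shrel_ex s.
exists C, (mor_comp f b), x; split; first exact: cov_mor_comp.
exact: glue_of.
Qed.

Definition glue : shsec A := ShSec glue_res glue_eq glue_local glue_ex.

Lemma shres_glue : shres f glue = s.
Proof.
apply: shsecP => C g x; split; last exact: glue_of.
move=> /(_ C (mor_id C) g); by rewrite res_id //; apply.
Qed.

End Glue.

Lemma shpsh_sheaf : is_sheaf shpsh.
Proof.
move=> A B P f i j cf ij s sij; exists (glue cf ij sij).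
split=> [|s' s's]; first exact: shres_glue.
by apply: (sh_sep cf); rewrite (shres_glue cf ij sij) -s's.
Qed.

Section Universal.
Variables (H : presheaf X) (eta : psh_map F H).
Hypothesis shH : is_sheaf H.

(** Two representatives of [s] are locally equal on a common refinement, and a sheaf turns local
    equality into equality. *)
Lemma eta_agree (A B C : obj X) (s : shsec A) (f : mor A B) (g : mor A C) x x'
    (D : obj X) (i : mor B D) (j : mor C D) :
  s B f x -> s C g x' -> i \o f =1 j \o g ->
  res i (eta B x) = res j (eta C x').
Proof.
move=> fx gx' ij; apply: (sheaf_sep shH); rewrite -!psh_nat.
have [||E [k [ck e]]] := @shrel_eq _ s D (mor_comp f i) (res i x) (res j x').
- exact: shrel_res fx.
- by apply: (shrel_res (f := g) _ gx') => y; apply: ij.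
by exists E, k; split=> //; rewrite -!psh_nat e.
Qed.

(** The image under [eta] of one representative on a covering is a matching family and descends.
    Agreement with any other representative is then checked on a common refinement. *)
Lemma shlift_ex (A : obj X) (s : shsec A) :
  exists y : H A, forall B (f : mor A B) x, s B f x -> res f y = eta B x.
Proof.
have [B [f [x [cf fx]]]] := shrel_ex s; have [P [i [j ij]]] := pushouts f cf.
have [|y [fy _]] := shH cf ij (x := eta B x).
  by apply: (eta_agree fx fx); case: ij.
exists y => C g x' gx'; have [Q [k [l [cl kl]]]] := cov_refine g cf.
apply: (sheaf_sep shH); exists Q, l; split=> //.
by rewrite -(res_square _ kl) fy; apply: eta_agree fx gx' kl.
Qed.

Definition shlift_fun (A : obj X) (s : shpsh A) : H A :=
  projT1 (cid (shlift_ex s)).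

Lemma shlift_funE (A B : obj X) (s : shpsh A) (f : mor A B) x :
  shrel s f x -> res f (shlift_fun s) = eta B x.
Proof. by rewrite /shlift_fun; case: cid => y /= yP /yP. Qed.

Lemma shlift_unique (A : obj X) (s : shpsh A) (y : H A) :
  (forall B (f : mor A B) x, shrel s f x -> res f y = eta B x) ->
  y = shlift_fun s.
Proof.
move=> yP; have [B [f [x [cf fx]]]] := shrel_ex s.
apply: (sheaf_sep shH); exists B, f; split=> //.
by rewrite (yP _ _ _ fx) (shlift_funE fx).
Qed.

Lemma shlift_nat (A B : obj X) (f : mor A B) (s : shpsh A) :
  shlift_fun (res f s) = res f (shlift_fun s).
Proof.
apply/esym/shlift_unique => C g x fgx.
by rewrite -res_mor_comp; apply: shlift_funE.
Qed.

Definition shlift : psh_map shpsh H := PshMap shlift_nat.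

Lemma shlift_theta (A : obj X) (x : F A) : shlift A (sh_theta A x) = eta A x.
Proof.
apply/esym/shlift_unique => B f y fxy.
rewrite -psh_nat; apply: (sheaf_sep shH); case: fxy => C [g [cg e]].
by exists C, g; split=> //; rewrite -!psh_nat e.
Qed.

End Universal.

Lemma sh_theta_sheafification : is_sheafification sh_theta.
Proof.
split=> [|H eta shH]; first exact: shpsh_sheaf.
exists (shlift eta shH); split=> [A x|u uE A s]; first exact: shlift_theta.
apply: shlift_unique => B f x /shres_unit fx.
by rewrite -psh_nat -uE -[sh_theta B x]fx.
Qed.

Variables (F' : presheaf X) (theta : psh_map F F').
Hypothesis thetaP : is_sheafification theta.

(** An arbitrary sheafification is known only by its universal property. Mapping it to the explicit
    model [shpsh] makes its equality visible. *)
Lemma sheafification_inj (A : obj X) (x y : F A) :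
  theta A x = theta A y -> loceq x y.
Proof.
move=> xy; have [u [uE _]] := thetaP.2 _ sh_theta shpsh_sheaf.
have : shrel (sh_theta A x) (mor_id A) y.
  by rewrite -uE xy uE /= /shunit_rel res_id //; apply: loceq_refl.
by rewrite /= /shunit_rel res_id.
Qed.

Lemma sheafification_surj (A : obj X) (y : F' A) :
  exists (B : obj X) (f : mor A B) (x : F B), cov X f /\ theta B x = res f y.
Proof.
have [u [uE _]] := thetaP.2 _ sh_theta shpsh_sheaf.
pose v := shlift theta thetaP.1.
(* Both the composite of [u] and [v] and the identity extend [theta] to an endomorphism of [F'], so
   uniqueness identifies them. Local surjectivity of the model thereby passes to [F']. *)
have vu (B : obj X) (z : F' B) : v B (u B z) = z.
  have [w [_ wU]] := thetaP.2 _ theta thetaP.1.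
  have vu_nat C D (f : mor C D) (t : F' C) :
    v D (u D (res f t)) = res f (v C (u C t)) by rewrite !psh_nat.
  pose idF := @PshMap _ _ F' F' (fun _ => id) (fun _ _ _ _ => erefl).
  have -> : v B (u B z) = w B z.
    apply: (wU (PshMap vu_nat)) => C x; rewrite /= uE.
    exact: (shlift_theta theta thetaP.1).
  by apply/esym/(wU idF).
have [B [f [x [cf fx]]]] := shrel_ex (u A y).
exists B, f, x; split=> //.
by rewrite -(shlift_theta theta thetaP.1 x) -[sh_theta B x](shres_unit fx)
  -[shres _ _]/(res f (u A y)) psh_nat vu.
Qed.

End Sheafify.

Lemma mod_resE (M : lmodType R) (A B : obj X) (f : mor A B) (m : M) a :
  res (p := mod_presheaf X M) f (pure (alg_str A) m a) =
  pure (alg_str B) m (f a).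
Proof. exact: tens_map_pure (mor_alg f) m a. Qed.

Section TopClosure.
Variables (M : lmodType R) (N : submodClosed M).

Definition incl_fun (A : obj X) (x : mod_presheaf X (sub_mod N) A) :
  mod_presheaf X M A := tens_map (alg_str A) (sub_incl N) idfun x.

Lemma incl_nat (A B : obj X) (f : mor A B) (x : mod_presheaf X (sub_mod N) A) :
  incl_fun (res f x) = res f (incl_fun x).
Proof.
rewrite /incl_fun /= /mod_res; have fP := mor_alg f.
have idP (C : alg R) r : idfun (alg_str C r) = alg_str C r by [].
elim/tens_ind: x => [|m a|x y IHx IHy].
- by rewrite !(tens_map0 _ fP, tens_map0 _ (idP _)).
- by rewrite !(tens_map_pure _ fP, tens_map_pure _ (idP _)).
- by rewrite !(tens_mapD _ fP, tens_mapD _ (idP _)) IHx IHy.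
Qed.

Definition incl_psh : psh_map (mod_presheaf X (sub_mod N)) (mod_presheaf X M) :=
  PshMap incl_nat.

Lemma top_closureP (s : M) : top_closure X N s <->
  exists (A : obj X) (f : mor (base_obj X) A),
    cov X f /\ pure (alg_str A) s 1 \in im_base (alg_str A) N.
Proof.
split=> [[Mtop [Ntop [tM [tN [k [tMP tNP kE [A [f [cf [y ky]]]]]]]]]]|].
  (* Three coverings are composed: [f] realizes the section in the image sheaf, [g] represents [y]
     by an element of the tensor product of [N], and [h] turns equality in [Mtop] into equality of
     tensors. *)
  have [B [g [x [cg gx]]]] := sheafification_surj tNP y.
  have : tM B (incl_fun x) = tM B (pure (alg_str B) s 1).
    rewrite -[LHS]kE gx psh_nat ky -res_mor_comp -psh_nat.
    by rewrite mod_resE rmorph1.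
  move=> /(sheafification_inj tMP)[C [h [ch e]]].
  exists C, (mor_comp (mor_comp f g) h); split.
    by do 2?apply: cov_mor_comp.
  apply/asboolP; exists (res (p := mod_presheaf X (sub_mod N)) h x).
  by rewrite -[LHS]/(incl_fun _) incl_nat e mod_resE rmorph1.
move=> [A [f [cf /asboolP[w wE]]]].
have [k [kE _]] := (sh_theta_sheafification (mod_presheaf X (sub_mod N))).2
  _ (psh_comp incl_psh (sh_theta (mod_presheaf X M)))
  (shpsh_sheaf (F := mod_presheaf X M)).
do 2!eexists; exists (sh_theta _), (sh_theta _), k.
split; try exact: sh_theta_sheafification; first exact: kE.
exists A, f; split=> //; exists (sh_theta (mod_presheaf X (sub_mod N)) A w).
by rewrite kE [LHS]/= /incl_fun wE -psh_nat mod_resE rmorph1.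
Qed.

End TopClosure.

End Sheafification.

(** * Forcing algebras *)

Lemma rmorph_ext (A B : pzSemiRingType) (f g : {rmorphism A -> B}) :
  f =1 g -> f = g.
Proof.
case: f => f [a b]; case: g => g [a' b'] fg.
have E : f = g by apply/funext.
move: a b a' b' {fg}; rewrite E => -[a] [b] [a'] [b'].
by rewrite (Prop_irrelevance a a') (Prop_irrelevance b b').
Qed.

(** * Finite type homomorphisms and pushouts of rings *)

Section SubRing.
Variables (P : comPzRingType) (S : subringClosed P).
Definition sub_ring := {x : P | x \in S}.
HB.instance Definition _ := SubChoice.on sub_ring.
HB.instance Definition _ :=
  GRing.SubChoice_isSubComPzRing.Build P _ sub_ring (subringClosedP _).
Definition sub_ring_incl : {rmorphism sub_ring -> P} := val.

Variables (B : comPzRingType) (f : {rmorphism B -> P}).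
Hypothesis fS : forall y, f y \in S.
Definition corestrict (y : B) : sub_ring := Sub (f y) (fS y).
Lemma corestrict_additive : zmod_morphism corestrict.
Proof. by move=> x y; apply: val_inj; rewrite [RHS]raddfB /= rmorphB. Qed.
Lemma corestrict_monoid : monoid_morphism corestrict.
Proof.
split=> [|x y]; apply: val_inj; first by rewrite [RHS]rmorph1 /= rmorph1.
by rewrite [RHS]rmorphM /= rmorphM.
Qed.
HB.instance Definition _ :=
  GRing.isZmodMorphism.Build B sub_ring corestrict corestrict_additive.
HB.instance Definition _ :=
  GRing.isMonoidMorphism.Build B sub_ring corestrict corestrict_monoid.
End SubRing.

Section Gen.
Variables (R B : comPzRingType) (n : nat) (f : {rmorphism R -> B}).
Variable b : 'I_n -> B.

Definition gen_pred : pred B := fun y => `[< exists p, peval f b p = y >].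

Lemma gen_closed : subring_closed gen_pred.
Proof.
split=> [|x y /asboolP[p <-] /asboolP[q <-]|x y /asboolP[p <-] /asboolP[q <-]].
- by apply/asboolP; exists (PCst 1); rewrite /= rmorph1.
- by apply/asboolP; exists (PAdd p (POpp q)).
- by apply/asboolP; exists (PMul p q).
Qed.

Definition gen : subringClosed B :=
  HB.pack gen_pred (GRing.isSubringClosed.Build B gen_pred gen_closed).

Lemma genP y : reflect (exists p, peval f b p = y) (y \in gen).
Proof. exact: asboolP. Qed.

Lemma gen_cst r : f r \in gen.
Proof. by apply/genP; exists (PCst r). Qed.

Lemma gen_var i : b i \in gen.
Proof. by apply/genP; exists (PVar i). Qed.
End Gen.

Lemma peval_rpred (R B C : comPzRingType) (n : nat) (f : {rmorphism R -> B})
    (b : 'I_n -> B) (h : {rmorphism B -> C}) (S : subringClosed C) p :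
  (forall r, h (f r) \in S) -> (forall i, h (b i) \in S) ->
  h (peval f b p) \in S.
Proof.
move=> fS bS; elim: p => [r|i|p IHp q IHq|p IHp|p IHp q IHq] //=.
- by rewrite rmorphD rpredD.
- by rewrite rmorphN rpredN.
- by rewrite rmorphM rpredM.
Qed.

Lemma finite_type_comp (A B C : comPzRingType) (f : {rmorphism A -> B})
    (g : {rmorphism B -> C}) (h : {rmorphism A -> C}) :
  h =1 g \o f -> finite_type f -> finite_type g -> finite_type h.
Proof.
move=> hE [n [b fb]] [m [c gc]].
pose bc (i : 'I_(n + m)) :=
  match split i with inl k => g (b k) | inr k => c k end.
have bcl k : bc (lshift m k) = g (b k) by rewrite /bc (unsplitK (inl _ k)).
have bcr k : bc (rshift n k) = c k by rewrite /bc (unsplitK (inr _ k)).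
exists (n + m)%N, bc => y; apply/genP; have [p <-] := gc y.
apply: (peval_rpred (h := idfun)) => [r|k]; last by rewrite /= -bcr gen_var.
have [q <-] := fb r; apply: (peval_rpred (h := g)) => [a|k].
  by have := gen_cst h bc a; rewrite hE.
by rewrite -bcl gen_var.
Qed.

Lemma finite_type_cancel (A B C : comPzRingType) (f : {rmorphism A -> B})
    (g : {rmorphism B -> C}) (h : {rmorphism A -> C}) :
  h =1 g \o f -> finite_type h -> finite_type g.
Proof.
move=> hE [n [b hb]]; exists n, b => y; apply/genP.
have [p <-] := hb y; apply: (peval_rpred (h := idfun)) => [r|k].
  by rewrite -[X in X \in _]/(h r) hE; apply: gen_cst.
exact: (gen_var g b k).
Qed.

Lemma finite_type_id (A : comPzRingType) :
  finite_type (idfun : {rmorphism A -> A}).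
Proof. by exists 0, (fun=> 0) => y; exists (PCst y). Qed.

Section Pushout.
Variables (A B C P : comPzRingType).
Variables (f : {rmorphism A -> B}) (g : {rmorphism A -> C}).
Variables (i : {rmorphism B -> P}) (j : {rmorphism C -> P}).

Lemma is_pushoutC : is_pushout f g i j -> is_pushout g f j i.
Proof.
move=> [ij U]; split=> [x|D h k hk]; first exact: esym (ij x).
have [x|u [ui uj uU]] := U D k h; first exact: esym (hk x).
by exists u; split=> // v vj vi; apply: uU.
Qed.

Lemma pushout_ext (D : comPzRingType) (u v : {rmorphism P -> D}) :
  is_pushout f g i j -> u \o i =1 v \o i -> u \o j =1 v \o j -> u =1 v.
Proof.
move=> [ij U] uvi uvj; have [x|w [_ _ wU]] := U D (v \o i) (v \o j).
  by rewrite /=; congr (v _); apply: ij.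
by move=> x; rewrite (wU u) ?(wU v).
Qed.

(** The subring of [P] generated over [C] by the [i (b k)] contains the images of [B] and [C]. The
    universal property maps [P] into it compatibly with the inclusion, so it is all of [P]. No
    explicit tensor product of rings is involved. *)
Lemma finite_type_pushout :
  is_pushout f g i j -> finite_type f -> finite_type j.
Proof.
move=> ij [n [b fb]].
have jS c : j c \in gen j (i \o b) by apply: gen_cst.
have iS y : i y \in gen j (i \o b).
  have [p <-] := fb y; apply: (peval_rpred (h := i)) => [r|k].
    by have /= -> := ij.1 r.
  exact: (gen_var j (i \o b)).
have [x|u [ui uj _]] := ij.2 _ (corestrict iS) (corestrict jS).
  by apply: val_inj; apply: ij.1.
exists n, (i \o b) => y; apply/genP.
have <- : sub_ring_incl _ (u y) = y by apply: (pushout_ext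
  (u := sub_ring_incl _ \o u) (v := idfun) ij) => x /=;
  rewrite ?[u _]ui ?[u _]uj.
exact: valP.
Qed.

End Pushout.

(** Cancellation in the pasting law for cocartesian squares. It turns base change of a morphism
    along [phi] into ordinary base change along [a]. *)
Lemma pushout_paste (R S A A' B B' : comPzRingType)
    (phi : {rmorphism R -> S}) (a0 : {rmorphism R -> A})
    (b0 : {rmorphism R -> B}) (a1 : {rmorphism S -> A'})
    (b1 : {rmorphism S -> B'}) (a : {rmorphism A -> A'})
    (b : {rmorphism B -> B'}) (f : {rmorphism A -> B})
    (f' : {rmorphism A' -> B'}) :
  is_pushout phi a0 a1 a -> is_pushout phi b0 b1 b ->
  f \o a0 =1 b0 -> f' \o a1 =1 b1 -> f' \o a =1 b \o f ->
  is_pushout f a b f'.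
Proof.
move=> Pa Pb fa f'a f'f; split=> [x|D h k hk]; first exact: esym (f'f x).
have [r|u [ub1 ub uU]] := Pb.2 D (k \o a1) h.
  rewrite /= -[b0 r]fa; have /= -> := hk (a0 r).
  by congr (k _); apply: Pa.1.
exists u; split=> // [|u' u'b u'f'].
  apply: (pushout_ext (u := u \o f') Pa) => x /=.
    by rewrite [f' _]f'a; apply: ub1.
  by rewrite [f' _]f'f [LHS]ub; apply: hk.
apply: uU => // x; rewrite -[RHS]u'f' /=; congr (u' _); exact: esym (f'a x).
Qed.

Definition ring_iso (A B : comPzRingType) (f : {rmorphism A -> B}) : Prop :=
  exists g : {rmorphism B -> A}, cancel f g /\ cancel g f.

Lemma ring_iso_comp (A B C : comPzRingType) (f : {rmorphism A -> B})
    (g : {rmorphism B -> C}) :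
  ring_iso f -> ring_iso g -> ring_iso (g \o f).
Proof.
move=> [f' [ff' f'f]] [g' [gg' g'g]]; exists (f' \o g').
by split; apply: can_comp.
Qed.

Lemma ring_iso_pushout (A B C P : comPzRingType) (f : {rmorphism A -> B})
    (g : {rmorphism A -> C}) (i : {rmorphism B -> P}) (j : {rmorphism C -> P}) :
  is_pushout f g i j -> ring_iso f -> ring_iso j.
Proof.
move=> ij [f' [ff' f'f]].
have [x|u [ui uj _]] := ij.2 C (g \o f') idfun; first by rewrite /= ff'.
exists u; split; first exact: uj.
apply: (pushout_ext (u := j \o u) (v := idfun) ij) => x /=.
  rewrite [u _]ui -[x in RHS]f'f; exact: esym (ij.1 _).
by rewrite [u _]uj.
Qed.

Lemma pushout_of_iso (A B C : comPzRingType) (f : {rmorphism A -> B})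
    (f' : {rmorphism B -> A}) (g : {rmorphism A -> C}) :
  cancel f f' -> cancel f' f -> is_pushout f g (g \o f') idfun.
Proof.
move=> ff' f'f; split=> [x|D h k hk]; first by rewrite /= ff'.
exists k; split=> // x; rewrite /= -[in RHS](f'f x); exact: esym (hk _).
Qed.

(** * Universal properties of presented algebras and forcing algebras *)

Section PalgLift.
Variables (R : comPzRingType) (n : nat) (E : pexp R n -> pexp R n -> Prop).

Definition palg_var (j : 'I_n) : palg E := \pi_(palg E)%qT (PVar j).

Lemma palg_piE p : \pi_(palg E)%qT p = peval (palg_str E) palg_var p.
Proof.
elim: p => [r|j|p IHp q IHq|p IHp|p IHp q IHq] //=; rewrite -?IHp -?IHq.
- exact: esym (palg_addE E p q).
- exact: esym (palg_oppE E p).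
- exact: esym (palg_mulE E p q).
Qed.

Variables (B : comPzRingType) (f : {rmorphism R -> B}) (b : 'I_n -> B).
Hypothesis bE : forall p q, E p q -> peval f b p = peval f b q.

Lemma peval_cong p q : pcong E p q -> peval f b p = peval f b q.
Proof.
elim=> {p q} //=; try by [move=> * ; congruence].
- by move=> p q r; rewrite addrA.
- by move=> p q; rewrite addrC.
- by move=> p; rewrite rmorph0 add0r.
- by move=> p; rewrite addNr rmorph0.
- by move=> p q r; rewrite mulrA.
- by move=> p q; rewrite mulrC.
- by move=> p; rewrite rmorph1 mul1r.
- by move=> p q r; rewrite mulrDl.
- by move=> x y; rewrite rmorphD.
- by move=> x y; rewrite rmorphM.
Qed.

Definition palg_lift (x : palg E) : B := peval f b (repr x).

Lemma palg_liftE p : palg_lift (\pi_(palg E)%qT p) = peval f b p.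
Proof. exact/peval_cong/palg_repr. Qed.

Lemma palg_lift_additive : zmod_morphism palg_lift.
Proof.
move=> x y; have -> : x - y = \pi_(palg E)%qT (PAdd (repr x) (POpp (repr y))).
  by rewrite palg_piE /= -!palg_piE !reprK.
by rewrite palg_liftE.
Qed.

Lemma palg_lift_monoid : monoid_morphism palg_lift.
Proof.
split=> [|x y]; first by rewrite -(rmorph1 f); apply: (palg_liftE (PCst 1)).
have -> : x * y = \pi_(palg E)%qT (PMul (repr x) (repr y)).
  by rewrite palg_piE /= -!palg_piE !reprK.
by rewrite palg_liftE.
Qed.

HB.instance Definition _ :=
  GRing.isZmodMorphism.Build (palg E) B palg_lift palg_lift_additive.
HB.instance Definition _ :=
  GRing.isMonoidMorphism.Build (palg E) B palg_lift palg_lift_monoid.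

Definition palg_liftr : {rmorphism palg E -> B} := palg_lift.

End PalgLift.

Lemma rmorph_peval (R B C : comPzRingType) (n : nat) (f : {rmorphism R -> B})
    (b : 'I_n -> B) (g : {rmorphism R -> C}) (c : 'I_n -> C)
    (h : {rmorphism B -> C}) p :
  h \o f =1 g -> h \o b =1 c -> h (peval f b p) = peval g c p.
Proof.
move=> hf hb; elim: p => [r|j|p IHp q IHq|p IHp|p IHp q IHq] /=.
- exact: hf.
- exact: hb.
- by rewrite rmorphD IHp IHq.
- by rewrite rmorphN IHp.
- by rewrite rmorphM IHp IHq.
Qed.

Lemma finite_type_palg (R : comPzRingType) (n : nat)
    (E : pexp R n -> pexp R n -> Prop) :
  finite_type (palg_str E).
Proof.
exists n, (palg_var E) => y.
by exists (repr y); rewrite -palg_piE reprK.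
Qed.
(* Stated by the universal property, so that it does not depend on the choice of
   the ring within its isomorphism class. *)
Definition is_forcing (A B : comPzRingType) (f : {rmorphism A -> B})
    (mu nu : nat) (D : 'M[A]_(mu, nu)) (t : 'cV[A]_mu) : Prop :=
  exists T : 'cV[B]_nu, map_mx f D *m T = map_mx f t /\
    forall (C : comPzRingType) (h : {rmorphism A -> C}) (c : 'cV[C]_nu),
      map_mx h D *m c = map_mx h t ->
      exists u : {rmorphism B -> C}, [/\ u \o f =1 h, map_mx u T = c &
        forall u' : {rmorphism B -> C},
          u' \o f =1 h -> map_mx u' T = c -> u' =1 u].

Lemma map_mx_sol (A B C : comPzRingType) (f : {rmorphism A -> B})
    (g : {rmorphism B -> C}) (h : {rmorphism A -> C}) (mu nu : nat)
    (D : 'M[A]_(mu, nu)) (t : 'cV[A]_mu) (T : 'cV[B]_nu) :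
  g \o f =1 h -> map_mx f D *m T = map_mx f t ->
  map_mx h D *m map_mx g T = map_mx h t.
Proof.
move=> gf e.
have hE m n (M : 'M[A]_(m, n)) : map_mx h M = map_mx g (map_mx f M).
  by rewrite -map_mx_comp; apply: eq_map_mx => x; apply: esym (gf x).
by rewrite !hE -map_mxM e.
Qed.

Lemma forcing_strP (A : comPzRingType) (mu nu : nat) (D : 'M[A]_(mu, nu))
    (t : 'cV[A]_mu) :
  is_forcing (forcing_str D t) D t.
Proof.
have rowE (C : comPzRingType) (h : {rmorphism A -> C}) (c : 'I_nu -> C) i :
    peval h c (\big[@PAdd A nu/PCst 0]_(j < nu) PMul (PCst (D i j)) (PVar j)) =
    \sum_j h (D i j) * c j.
  elim/big_rec2: _ => [|j p q _ IH]; first by rewrite /= rmorph0.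
  by rewrite /= -IH.
exists (\col_j palg_var (forcing_rel D t) j); split.
  apply/matrixP=> i k; rewrite !mxE (ord1 k).
  under eq_bigr => j _ do rewrite !mxE.
  rewrite -rowE -palg_piE; apply: palg_eq; apply: pcong_rel.
  by exists i.
move=> C h c hc.
have cE p q : forcing_rel D t p q ->
    peval h (c ^~ 0) p = peval h (c ^~ 0) q.
  move=> [i [-> ->]]; rewrite rowE /=.
  have := congr1 (fun M : 'cV_mu => M i 0) hc; rewrite !mxE => <-.
  by apply: eq_bigr => j _; rewrite !mxE.
exists (palg_liftr cE); split=> [a||u' u'h u'T x].
- exact: (palg_liftE cE (PCst a)).
- apply/matrixP=> j k; rewrite !mxE (ord1 k); exact: (palg_liftE cE (PVar j)).
- rewrite -[x]reprK palg_piE; transitivity (peval h (c ^~ 0) (repr x)).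
    apply: rmorph_peval => // j.
    by have := congr1 (fun M : 'cV_nu => M j 0) u'T; rewrite !mxE.
  by rewrite -palg_piE; apply: esym (palg_liftE cE _).
Qed.

Section BaseChange.
Variables (A B C P : comPzRingType) (f : {rmorphism A -> B}).
Variables (g : {rmorphism A -> C}) (j : {rmorphism C -> P}).
Variables (mu nu : nat) (D : 'M[A]_(mu, nu)) (t : 'cV[A]_mu).

(** The universal solution over [P] of the transported system is also a solution of the original
    one, hence receives a map from [B]. This is the source of fibre products along coverings. *)
Lemma forcing_pushout :
  is_forcing f D t -> is_forcing j (map_mx g D) (map_mx g t) ->
  exists i : {rmorphism B -> P}, is_pushout f g i j.
Proof.
move=> [T [fT fU]] [T' [jT' jU]].
have jgT' : map_mx (j \o g) D *m T' = map_mx (j \o g) t.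
  by rewrite !(map_mx_comp g j).
have [i [if' iT _]] := fU P (j \o g) T' jgT'.
exists i; split=> [|E h k hk]; first exact: if'.
have [|u [uj uT' uU]] := jU E k (map_mx h T).
  rewrite -!map_mx_comp; apply: map_mx_sol fT; exact: hk.
exists u; split=> // [y|u' u'i u'j].
  have [|v [_ _ vU]] := fU E (h \o f) (map_mx h T); first exact: map_mx_sol fT.
  rewrite (vU h) // (vU (u \o i)) // => [x|].
    by rewrite /= [i _]if' /= [u _]uj; apply: esym (hk x).
  by rewrite -uT' -iT map_mx_comp.
apply: uU => //; rewrite -iT -map_mx_comp; exact: eq_map_mx.
Qed.

(** A solution of the transported system in a [C]-algebra is a solution of the original system in
    the underlying [A]-algebra. Any pushout is allowed here, as the axiom on base change of
    coverings demands. *)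
Lemma forcing_base (i : {rmorphism B -> P}) :
  is_pushout f g i j -> is_forcing f D t ->
  is_forcing j (map_mx g D) (map_mx g t).
Proof.
move=> ij [T [fT fU]]; exists (map_mx i T); split=> [|E h c].
  by rewrite -!map_mx_comp; apply: map_mx_sol fT; apply: ij.1.
rewrite -!map_mx_comp => /(fU E (h \o g)) [v [vf vT vU]].
have [u [ui uj uU]] := ij.2 E v h vf.
exists u; split=> // [|u' u'j].
  by rewrite -map_mx_comp -vT; apply: eq_map_mx.
rewrite -map_mx_comp => u'T; apply: uU => //; apply: vU => //.
by move=> x; rewrite /= [i _](ij.1 x); apply: u'j.
Qed.

End BaseChange.

Section Composition.
Variables (A B C : comPzRingType).
Variables (f : {rmorphism A -> B}) (g : {rmorphism B -> C}).
Variables (mu nu : nat) (D : 'M[A]_(mu, nu)) (t : 'cV[A]_mu).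

Lemma forcing_isol :
  ring_iso f -> is_forcing g (map_mx f D) (map_mx f t) ->
  is_forcing (g \o f) D t.
Proof.
move=> [f' [ff' f'f]] [T [gT gU]]; exists T; split=> [|E h c hc].
  by rewrite !(map_mx_comp f g).
have hfE m n (M : 'M[A]_(m, n)) : map_mx (h \o f') (map_mx f M) = map_mx h M.
  by rewrite -map_mx_comp; apply: eq_map_mx => x; rewrite /= ff'.
have [|u [ug uT uU]] := gU E (h \o f') c; first by rewrite !hfE.
exists u; split=> // [x|u' u'gf u'T].
  by rewrite /= [u _]ug /= ff'.
by apply: uU => // x; rewrite /= -[RHS]u'gf /= f'f.
Qed.

Lemma forcing_isor :
  is_forcing f D t -> ring_iso g -> is_forcing (g \o f) D t.
Proof.
move=> [T [fT fU]] [g' [gg' g'g]]; exists (map_mx g T); split=> [|E h c hc].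
  exact: map_mx_sol fT.
have [u [uf uT uU]] := fU E h c hc.
exists (u \o g'); split=> [x||u' u'gf].
- by rewrite /= gg'; apply: uf.
- by rewrite -map_mx_comp -uT; apply: eq_map_mx => x; rewrite /= gg'.
rewrite -map_mx_comp => u'T x.
by rewrite -[x in LHS]g'g; apply: (uU (u' \o g)).
Qed.

(** The block system decouples, by [solE], into the two given ones. This needs the second system to
    be defined over [A] already, not merely over [B]. *)
Lemma forcing_comp (mu' nu' : nat) (D' : 'M[A]_(mu', nu')) (t' : 'cV[A]_mu') :
  is_forcing f D t -> is_forcing g (map_mx f D') (map_mx f t') ->
  is_forcing (g \o f) (block_mx D 0 0 D') (col_mx t t').
Proof.
move=> [T [fT fU]] [T' [gT' gU]].
have solE (E : comPzRingType) (h : {rmorphism A -> E}) c c' :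
    map_mx h (block_mx D 0 0 D') *m col_mx c c' = map_mx h (col_mx t t') <->
    map_mx h D *m c = map_mx h t /\ map_mx h D' *m c' = map_mx h t'.
  rewrite map_block_mx map_col_mx !map_mx0 mul_block_col !mul0mx addr0 add0r.
  by split=> [/eq_col_mx|[-> ->]].
exists (col_mx (map_mx g T) T'); split=> [|E h c].
  apply/solE; split; first exact: map_mx_sol fT.
  by rewrite !(map_mx_comp f g).
rewrite -[c]vsubmxK => /solE[hc hc'].
have [v [vf vT vU]] := fU E h (usubmx c) hc.
have vfE m n (M : 'M[A]_(m, n)) : map_mx v (map_mx f M) = map_mx h M.
  by rewrite -map_mx_comp; apply: eq_map_mx.
have [|u [ug uT' uU]] := gU E v (dsubmx c); first by rewrite !vfE.
exists u; split=> [x||u' u'h]; first by rewrite /= [u _]ug; apply: vf.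
  rewrite map_col_mx uT' -map_mx_comp -vT; congr col_mx; exact: eq_map_mx.
rewrite map_col_mx -map_mx_comp => /eq_col_mx[u'T u'T'].
by apply: uU => //; apply: (vU (u' \o g)).
Qed.

End Composition.

(** * Quotients, tensor products and presentations of M / N *)

Lemma submod_rpredN (R : comPzRingType) (M : lmodType R) (N : submodClosed M)
    x :
  (- x \in N) = (x \in N).
Proof.
have oppN y : y \in N -> - y \in N by rewrite -scaleN1r; apply: rpredZ.
by apply/idP/idP=> [/oppN|/oppN //]; rewrite opprK.
Qed.

Lemma submod_rpredB (R : comPzRingType) (M : lmodType R) (N : submodClosed M)
    x y :
  x \in N -> y \in N -> x - y \in N.
Proof. by move=> xN yN; rewrite rpredD ?submod_rpredN. Qed.

Section QuotientModule.
Variables (R : comPzRingType) (M : lmodType R) (N : submodClosed M).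
Local Open Scope quotient_scope.

Definition modb : rel M := fun x y => x - y \in N.

Lemma modb_equiv : equiv_class_of modb.
Proof.
split=> [x|x y|y x z]; rewrite /modb; first by rewrite subrr rpred0.
  by rewrite -opprB submod_rpredN.
by move=> xy yz; rewrite -(subrKA y) rpredD.
Qed.

Canonical modb_equiv_rel := EquivRelPack modb_equiv.
Canonical modb_encModRel := defaultEncModRel modb.

Definition quot_mod := {eq_quot modb}.
HB.instance Definition _ := Choice.on quot_mod.

Lemma quot_eq x y : x - y \in N -> \pi_quot_mod x = \pi_quot_mod y.
Proof. by move=> xy; apply/eqmodP. Qed.

Lemma quot_repr x : repr (\pi_quot_mod x) - x \in N.
Proof. by have /eqmodP := reprK (\pi_quot_mod x). Qed.

Definition quot_add (x y : quot_mod) := \pi_quot_mod (repr x + repr y).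
Definition quot_opp (x : quot_mod) := \pi_quot_mod (- repr x).
Definition quot_scale (a : R) (x : quot_mod) := \pi_quot_mod (a *: repr x).

Lemma quot_addE x y :
  quot_add (\pi_quot_mod x) (\pi_quot_mod y) = \pi_quot_mod (x + y).
Proof. by apply: quot_eq; rewrite opprD addrACA rpredD ?quot_repr. Qed.

Lemma quot_oppE x : quot_opp (\pi_quot_mod x) = \pi_quot_mod (- x).
Proof. by apply: quot_eq; rewrite -opprD submod_rpredN quot_repr. Qed.

Lemma quot_scaleE a x : quot_scale a (\pi_quot_mod x) = \pi_quot_mod (a *: x).
Proof. by apply: quot_eq; rewrite -scalerBr rpredZ ?quot_repr. Qed.

Lemma quot_addA : associative quot_add.
Proof.
elim/quotW=> x; elim/quotW=> y; elim/quotW=> z.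
by rewrite (quot_addE y) (quot_addE x) (quot_addE x) quot_addE addrA.
Qed.
Lemma quot_addC : commutative quot_add.
Proof. by move=> x y; rewrite /quot_add addrC. Qed.
Lemma quot_add0 : left_id (\pi_quot_mod 0) quot_add.
Proof. by elim/quotW=> x; rewrite quot_addE add0r. Qed.
Lemma quot_addN : left_inverse (\pi_quot_mod 0) quot_opp quot_add.
Proof. by elim/quotW=> x; rewrite quot_oppE quot_addE addNr. Qed.

HB.instance Definition _ :=
  GRing.isZmodule.Build quot_mod quot_addA quot_addC quot_add0 quot_addN.

Lemma quot_scaleA a b x : quot_scale a (quot_scale b x) = quot_scale (a * b) x.
Proof. by elim/quotW: x => x; rewrite (quot_scaleE b) !quot_scaleE scalerA. Qed.
Lemma quot_scale1 : left_id 1 quot_scale.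
Proof. by elim/quotW=> x; rewrite quot_scaleE scale1r. Qed.
Lemma quot_scaleDr : right_distributive quot_scale +%R.
Proof.
move=> a; elim/quotW=> x; elim/quotW=> y.
rewrite (quot_scaleE a x) (quot_scaleE a y).
by rewrite [X in quot_scale a X]quot_addE quot_scaleE scalerDr [RHS]quot_addE.
Qed.
Lemma quot_scaleDl (x : quot_mod) :
  {morph (fun a => quot_scale a x : quot_mod) : a b / a + b}.
Proof.
elim/quotW: x => x a b.
by rewrite !quot_scaleE scalerDl [RHS]quot_addE.
Qed.

HB.instance Definition _ := GRing.Zmodule_isLmodule.Build R quot_mod
  quot_scaleA quot_scale1 quot_scaleDr quot_scaleDl.

Definition quot_pi_fun (x : M) : quot_mod := \pi_quot_mod x.

Lemma quot_pi_linear : linear quot_pi_fun.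
Proof.
move=> a x y; rewrite /quot_pi_fun -quot_addE -quot_scaleE; exact.
Qed.

HB.instance Definition _ :=
  GRing.isLinear.Build R M quot_mod *:%R quot_pi_fun quot_pi_linear.

Definition quot_pi : {linear M -> quot_mod} := quot_pi_fun.

Lemma quot_piP : is_quotient N quot_pi.
Proof.
split=> [y|m]; first by exists (repr y); apply: reprK.
split=> [m0|mN].
  have /eqmodP : \pi_quot_mod m = \pi_quot_mod 0 by [].
  by rewrite /= /modb subr0.
by apply: quot_eq; rewrite subr0.
Qed.

End QuotientModule.

Section TensLift.
Variables (R S : comPzRingType) (phi : {rmorphism R -> S}) (M : lmodType R).
Variables (V : lmodType S) (g : M -> V).
Hypotheses (gD : {morph g : x y / x + y}).
Hypotheses (gZ : forall a m, g (a *: m) = phi a *: g m).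

Fixpoint texp_lift (p : texp M S) : V :=
  match p with
  | TZero => 0
  | TPure m s => s *: g m
  | TAdd p q => texp_lift p + texp_lift q
  | TOpp p => - texp_lift p
  end.

Lemma texp_lift_cong p q : tcong phi p q -> texp_lift p = texp_lift q.
Proof.
elim=> {p q} //=; try by [move=> * ; congruence].
- by move=> p q r; rewrite addrA.
- by move=> p q; rewrite addrC.
- by move=> p; rewrite add0r.
- by move=> p; rewrite addNr.
- by move=> m m' s; rewrite gD scalerDr.
- by move=> m s s'; rewrite scalerDl.
- by move=> a m s; rewrite gZ scalerA mulrC.
Qed.

Definition tens_lift (x : tens phi M) : V := texp_lift (repr x).

Lemma tens_liftE p : tens_lift (\pi_(tens phi M)%qT p) = texp_lift p.
Proof. exact/texp_lift_cong/tens_repr. Qed.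

Lemma tens_lift_linear : linear tens_lift.
Proof.
move=> a x y; rewrite -[x]reprK -[y]reprK [a *: _]tens_scaleE -pi_tensD.
rewrite !tens_liftE /=; congr (_ + _).
elim: (repr x) => /= [|m s|p -> q ->|p ->].
- by rewrite scaler0.
- by rewrite scalerA.
- by rewrite scalerDr.
- by rewrite scalerN.
Qed.

HB.instance Definition _ :=
  GRing.isLinear.Build S (tens phi M) V *:%R tens_lift tens_lift_linear.

Definition tens_liftr : {linear tens phi M -> V} := tens_lift.

Lemma tens_liftr_pure m s : tens_liftr (pure phi m s) = s *: g m.
Proof. exact: tens_liftE. Qed.

End TensLift.

Lemma pure_im_base (R S : comPzRingType) (phi : {rmorphism R -> S})
    (M : lmodType R) (N : submodClosed M) n s :
  n \in N -> pure phi n s \in im_base phi N.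
Proof.
move=> nN; apply/asboolP; exists (pure phi (Sub n nN : sub_mod N) s).
exact: (tens_map_pure (phi' := phi) (sub_incl N) (h := idfun)).
Qed.

(** * Presentations of M / N by elements of M, and their base change *)

Section Frames.
Variables (R : comPzRingType) (M : lmodType R).

Definition comb (mu : nat) (m_ : 'I_mu -> M) (v : 'cV[R]_mu) : M :=
  \sum_i v i 0 *: m_ i.

Section Comb.
Variables (mu : nat) (m_ : 'I_mu -> M).

Lemma comb_linear : linear (comb m_).
Proof.
move=> a v w; rewrite /comb scaler_sumr -big_split /=.
by apply: eq_bigr => i _; rewrite !mxE scalerDl scalerA.
Qed.

HB.instance Definition _ :=
  GRing.isLinear.Build R 'cV[R]_mu M *:%R (comb m_) comb_linear.

Lemma comb_delta i : comb m_ (delta_mx i 0) = m_ i.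
Proof.
rewrite /comb (bigD1 i) //= big1 ?addr0 => [|k /negPf ki]; rewrite !mxE ?eqxx.
  by rewrite scale1r.
by rewrite ki scale0r.
Qed.

End Comb.

Lemma col_sum (m : nat) (v : 'cV[R]_m) : v = \sum_i v i 0 *: delta_mx i 0.
Proof.
by rewrite [v in LHS]matrix_sum_delta; apply: eq_bigr => i _; rewrite big_ord1.
Qed.

Lemma linear_comb (V : lmodType R) (mu : nat) (f : {linear 'cV[R]_mu -> V}) v :
  f v = \sum_i v i 0 *: f (delta_mx i 0).
Proof.
by rewrite {1}[v]col_sum linear_sum; apply: eq_bigr => i _; rewrite linearZ.
Qed.

Variables (N : submodClosed M) (s : M).

(* The [m_ i] lift to [M] the images of the standard basis under the
   presentation of [M / N]. *)
Definition frame (mu nu : nat) (D : 'M[R]_(mu, nu)) (m_ : 'I_mu -> M) : Prop :=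
  (forall m, exists v, m - comb m_ v \in N) /\
  (forall v, comb m_ v \in N <-> exists w : 'cV[R]_nu, v = D *m w).

(** Removes the quotient module from the data by lifting generators to [M]. Base change and direct
    sums can then be computed on elements of [M]. *)
Lemma forcing_dataP (mu nu : nat) (D : 'M[R]_(mu, nu)) (t : 'cV[R]_mu) :
  forcing_data D t N s <->
  exists m_ : 'I_mu -> M, frame D m_ /\ s - comb m_ t \in N.
Proof.
split=> [[Q [q [p [[qS qN] [pS pD] pt]]]]|[m_ [[mS mD] st]]].
  have [m_ mE] := choice (fun i : 'I_mu => qS (p (delta_mx i 0))).
  have qcomb v : q (comb m_ v) = p v.
    rewrite linear_sum [RHS]linear_comb; apply: eq_bigr => i _.
    by rewrite linearZ /= mE.
  have combN m v : m - comb m_ v \in N <-> q m = p v.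
    rewrite -qN linearB qcomb; split=> [/eqP|->]; last by rewrite subrr.
    by rewrite subr_eq0 => /eqP.
  exists m_; split; last by apply/combN.
  split=> [m|v]; last by rewrite -pD -qcomb -qN.
  by have [v pv] := pS (q m); exists v; apply/combN.
have [qS qN] := quot_piP N.
exists (quot_mod N), (quot_pi N), (quot_pi N \o comb m_).
have combE m v : m - comb m_ v \in N -> quot_pi N (comb m_ v) = quot_pi N m.
  by move=> /qN; rewrite linearB => /eqP; rewrite subr_eq0 => /eqP.
split; [exact: quot_piP | | exact: combE].
split=> [y|v]; last by rewrite -mD -qN.
have [m <-] := qS y; have [v /combE mv] := mS m.
by exists v.
Qed.

End Frames.

Lemma linear_subD (R : pzRingType) (U V : lmodType R) (f : {linear U -> V})
    x y v w :
  x + y - f (v + w) = (x - f v) + (y - f w).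
Proof. by rewrite linearD opprD addrACA. Qed.

Section FrameBaseChange.
Variables (R S : comPzRingType) (phi : {rmorphism R -> S}) (M : lmodType R).
Variables (N : submodClosed M) (mu nu : nat) (D : 'M[R]_(mu, nu)).
Variable m_ : 'I_mu -> M.

Definition pure1 (i : 'I_mu) : tens phi M := pure phi (m_ i) 1.

Lemma pure_suml (I : Type) (r : seq I) (F : I -> M) s :
  pure phi (\sum_(i <- r) F i) s = \sum_(i <- r) pure phi (F i) s.
Proof.
have pure0l : pure phi (0 : M) s = 0.
  by apply: (addrI (pure phi 0 s)); rewrite -pureDl !addr0.
elim/big_rec2: _ => [|i x y _ <-]; first exact: pure0l.
exact: pureDl.
Qed.

Lemma pureBl (m m' : M) s : pure phi (m - m') s = pure phi m s - pure phi m' s.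
Proof. by apply: (canRL (addrK _)); rewrite -pureDl subrK. Qed.

Lemma pure_comb v s :
  pure phi (comb m_ v) s = comb pure1 (s *: map_mx phi v).
Proof.
rewrite pure_suml; apply: eq_bigr => i _.
by rewrite scale_pure !mxE mulr1 pureZ mulrC.
Qed.

Hypothesis Dm : frame N D m_.

Lemma comb_map_mul (w : 'cV[S]_nu) :
  comb pure1 (map_mx phi D *m w) \in im_base phi N.
Proof.
rewrite [w]col_sum mulmx_sumr linear_sum rpred_sum // => j _.
rewrite -scalemxAr.
have -> : map_mx phi D *m delta_mx j 0 =
    map_mx phi (D *m delta_mx j 0 : 'cV_mu).
  by rewrite map_mxM map_delta_mx.
rewrite /= -pure_comb pure_im_base //; apply/Dm.2.
by exists (delta_mx j 0).
Qed.

(** Right exactness of the tensor product, by hand. Generation is checked on pure tensors. For the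
    relations, an explicit map [u] from the tensor product to the cokernel of [map_mx phi D] kills
    the image of [N] and recovers the class of a coordinate vector. *)
Lemma frame_base : frame (im_base phi N) (map_mx phi D) pure1.
Proof.
have [mS mD] := Dm; split.
  elim/tens_ind => [|m s|x y [v vx] [w wy]].
  - by exists 0; rewrite linear0 subr0 rpred0.
  - have [v mv] := mS m; exists (s *: map_mx phi v).
    by rewrite -pure_comb -pureBl pure_im_base.
  - by exists (v + w); rewrite (linear_subD (comb pure1)) rpredD.
move=> v; split=> [vN|[w ->]]; last exact: comb_map_mul.
pose W : pred 'cV[S]_mu := fun v => `[< exists w, v = map_mx phi D *m w >].
have W_closed : submod_closed W.
  split=> [|a x y /asboolP[w ->] /asboolP[w' ->]]; apply/asboolP.
    by exists 0; rewrite mulmx0.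
  by exists (a *: w + w'); rewrite mulmxDr -scalemxAr.
pose WC : submodClosed 'cV[S]_mu :=
  HB.pack W (GRing.isSubmodClosed.Build S 'cV[S]_mu W W_closed).
have [_ WP] := quot_piP WC.
have [c_ cP] := choice mS.
(* The coordinates [c_ m] are an arbitrary choice. By [gE] another choice changes them by a vector D
   w, whose image lies in [W], so [g] is additive and semilinear although [c_] is not. *)
pose g m := quot_pi WC (map_mx phi (c_ m)).
have gE m u : m - comb m_ u \in N -> g m = quot_pi WC (map_mx phi u).
  move=> mu_; apply/eqP; rewrite -subr_eq0 -linearB /=; apply/eqP/WP/asboolP.
  have /mD[w uw] : comb m_ (c_ m - u) \in N.
    have -> : comb m_ (c_ m - u) = (m - comb m_ u) - (m - comb m_ (c_ m)).
      by rewrite linearB opprB [RHS]addrC addrA subrK.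
    by rewrite submod_rpredB.
  by exists (map_mx phi w); rewrite -map_mxB uw map_mxM.
have gD : {morph g : x y / x + y}.
  move=> x y; have /gE -> : x + y - comb m_ (c_ x + c_ y) \in N.
    by rewrite (linear_subD (comb m_)) rpredD.
  by rewrite map_mxD linearD.
have gZ a m : g (a *: m) = phi a *: g m.
  have /gE -> : a *: m - comb m_ (a *: c_ m) \in N.
    by rewrite linearZ -scalerBr rpredZ.
  by rewrite map_mxZ linearZ.
pose u : {linear tens phi M -> quot_mod WC} := tens_liftr gD gZ.
have u_pure m s : u (pure phi m s) = s *: g m by apply: tens_liftr_pure.
have uN x : x \in im_base phi N -> u x = 0.
  move=> /asboolP[y <-]; have idP r : idfun (phi r) = phi r by [].
  elim/tens_ind: y => [|n s|y z IHy IHz].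
  - by rewrite (tens_map0 _ idP) linear0.
  - rewrite (tens_map_pure _ idP) u_pure (gE _ 0); last first.
      by rewrite linear0 subr0; apply: valP.
    by rewrite map_mx0 linear0.
  - by rewrite (tens_mapD (sub_incl N) idP) linearD IHy IHz addr0.
(* The class of [v] is the value of [u] at [comb pure1 v], which lies in the image of [N]. *)
have : quot_pi WC v = 0.
  rewrite -(uN _ vN) [v in LHS]col_sum !linear_sum; apply: eq_bigr => i _.
  rewrite !linearZ u_pure scale1r (gE _ (delta_mx i 0)) ?map_delta_mx //.
  by rewrite comb_delta subrr rpred0.
by move=> /WP/asboolP.
Qed.

End FrameBaseChange.

Lemma forcing_data_base (R S : comPzRingType) (phi : {rmorphism R -> S})
    (M : lmodType R) (N : submodClosed M) (s : M) (mu nu : nat)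
    (D : 'M[R]_(mu, nu)) (t : 'cV[R]_mu) :
  forcing_data D t N s ->
  forcing_data (map_mx phi D) (map_mx phi t) (im_base phi N) (pure phi s 1).
Proof.
move=> /forcing_dataP[m_ [Dm st]]; apply/forcing_dataP.
exists (pure1 phi m_); split; first exact: frame_base.
by rewrite -[map_mx phi t]scale1r -pure_comb -pureBl pure_im_base.
Qed.

(** Modulo [N], [s] is the combination with coefficients [t]. After base change this becomes the
    combination with coefficients D T, and the columns of D are relations modulo [N]. *)
Lemma solution_im_base (R S : comPzRingType) (phi : {rmorphism R -> S})
    (M : lmodType R) (N : submodClosed M) (s : M) (mu nu : nat)
    (D : 'M[R]_(mu, nu)) (t : 'cV[R]_mu) (T : 'cV[S]_nu) :
  forcing_data D t N s -> map_mx phi D *m T = map_mx phi t ->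
  pure phi s 1 \in im_base phi N.
Proof.
move=> /forcing_dataP[m_ [Dm st]] DT.
rewrite -(subrK (comb m_ t) s) pureDl rpredD //; first exact: pure_im_base.
by rewrite (pure_comb phi m_) scale1r -DT comb_map_mul.
Qed.

(** Varies ring and module at once. With [h] the identity it serves functoriality of the closure;
    with [f] the identity it moves membership from a covering to a forcing algebra under it. *)
Lemma im_base_map (R S S' : comPzRingType) (phi : {rmorphism R -> S})
    (phi' : {rmorphism R -> S'}) (h : {rmorphism S -> S'}) (M M' : lmodType R)
    (N : submodClosed M) (N' : submodClosed M') (f : {linear M -> M'}) (s : M) :
  h \o phi =1 phi' -> (forall n, n \in N -> f n \in N') ->
  pure phi s 1 \in im_base phi N -> pure phi' (f s) 1 \in im_base phi' N'.
Proof.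
move=> hphi fN /asboolP[w ws].
have -> : pure phi' (f s) 1 = tens_map phi' f h (pure phi s 1).
  by rewrite tens_map_pure // rmorph1.
rewrite -ws; have idP r : idfun (phi r) = phi r by [].
elim/tens_ind: w {ws} => [|n a|x y IHx IHy].
- by rewrite (tens_map0 _ idP) tens_map0 // rpred0.
- rewrite (tens_map_pure _ idP) tens_map_pure // pure_im_base //.
  by apply: fN; apply: valP.
- by rewrite (tens_mapD (sub_incl N) idP) tens_mapD // rpredD.
Qed.

(** Relations of M / N are the relations of [M] together with generators of [N], written in the
    generators of [M]. The matrix is fixed before [s]; only the right-hand side [t] depends on
    [s]. *)
Lemma forcing_data_exists (R : comPzRingType) (M : lmodType R)
    (N : submodClosed M) :
  finitely_presented M -> finitely_presented (sub_mod N : lmodType R) ->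
  exists (mu nu : nat) (D : 'M[R]_(mu, nu)),
    forall s : M, exists t, forcing_data D t N s.
Proof.
move=> [mu [nu [D [p [pS pD]]]]] [k [_ [_ [p' [p'S _]]]]].
have [e eE] := choice (fun j : 'I_k => pS (val (p' (delta_mx j 0)))).
(* The columns of [E] are coordinates in [M] of the generators of [N]. *)
pose E : 'M_(mu, k) := \matrix_(i, j) e j i 0.
have pE w : p (E *m w) = val (p' w).
  have -> : E *m w = \sum_j w j 0 *: e j.
    apply/colP=> i; rewrite !mxE summxE; apply: eq_bigr => j _.
    by rewrite !mxE mulrC.
  rewrite linear_sum linear_comb raddf_sum; apply: eq_bigr => j _.
  by rewrite linearZ eE.
pose m_ i := p (delta_mx i 0).
have combE v : comb m_ v = p v by rewrite linear_comb.
have DE_frame : frame N (row_mx D E) m_.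
  split=> [m|v].
    by have [v <-] := pS m; exists v; rewrite combE subrr rpred0.
  rewrite combE; split=> [vN|[w ->]].
    have [w' w'E] := p'S (Sub (p v) vN).
    have /pD[w vw] : p (v - E *m w') = 0.
      by rewrite linearB pE w'E subrr.
    by exists (col_mx w w'); rewrite mul_row_col -vw subrK.
  rewrite -[w]vsubmxK mul_row_col linearD pE.
  have /pD -> : exists w', D *m usubmx w = D *m w' by exists (usubmx w).
  by rewrite add0r; apply: valP.
exists mu, (nu + k)%N, (row_mx D E) => s; have [t ts] := DE_frame.1 s.
by exists t; apply/forcing_dataP; exists m_.
Qed.

Section Sums.
Variables (R : comPzRingType) (M M' : lmodType R).
Variables (N : submodClosed M) (N' : submodClosed M').

Definition prod_sub_pred : pred (M * M')%type :=
  fun x => (x.1 \in N) && (x.2 \in N').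

Lemma prod_sub_closed : submod_closed prod_sub_pred.
Proof.
split=> [|a x y /andP[x1 x2] /andP[y1 y2]]; apply/andP.
  by rewrite !rpred0.
by split; rewrite rpredD ?rpredZ.
Qed.

Definition prod_sub : submodClosed (M * M')%type :=
  HB.pack prod_sub_pred
    (GRing.isSubmodClosed.Build R (M * M')%type prod_sub_pred prod_sub_closed).

Lemma prod_subE x : (x \in prod_sub) = (x.1 \in N) && (x.2 \in N').
Proof. by []. Qed.

Lemma prod_sub_of_proof (x : sub_mod N * sub_mod N') :
  (val x.1, val x.2) \in prod_sub.
Proof. by apply/andP; split; apply: valP. Qed.

Definition prod_sub_of (x : sub_mod N * sub_mod N') : sub_mod prod_sub :=
  Sub (val x.1, val x.2) (prod_sub_of_proof x).

Lemma prod_sub_of_linear : linear prod_sub_of.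
Proof. by move=> a x y; apply: val_inj. Qed.

HB.instance Definition _ := GRing.isLinear.Build R
  (sub_mod N * sub_mod N')%type (sub_mod prod_sub) *:%R prod_sub_of
  prod_sub_of_linear.

(** Lets repleteness carry membership in [MM] from the product of the two submodules to the
    submodule of the product. *)
Lemma prod_sub_of_bij : bijective prod_sub_of.
Proof.
have p1 (x : sub_mod prod_sub) : (val x).1 \in N by case/andP: (valP x).
have p2 (x : sub_mod prod_sub) : (val x).2 \in N' by case/andP: (valP x).
exists (fun x => (Sub (val x).1 (p1 x), Sub (val x).2 (p2 x))) => x.
  by case: x => x y; congr pair; apply: val_inj.
by apply: val_inj => /=; case: (val x).
Qed.

Lemma forcing_data_sum (s : M) (s' : M') (mu nu mu' nu' : nat)
    (D : 'M[R]_(mu, nu)) (t : 'cV[R]_mu) (D' : 'M[R]_(mu', nu'))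
    (t' : 'cV[R]_mu') :
  forcing_data D t N s -> forcing_data D' t' N' s' ->
  forcing_data (block_mx D 0 0 D') (col_mx t t') prod_sub (s, s').
Proof.
move=> /forcing_dataP[m_ [[mS mD] st]] /forcing_dataP[m'_ [[mS' mD'] st']].
apply/forcing_dataP.
pose n_ (i : 'I_(mu + mu')) : M * M' :=
  match split i with inl k => (m_ k, 0) | inr k => (0, m'_ k) end.
have n_l k : n_ (lshift mu' k) = (m_ k, 0) by rewrite /n_ (unsplitK (inl _ k)).
have n_r k : n_ (rshift mu k) = (0, m'_ k) by rewrite /n_ (unsplitK (inr _ k)).
have nE v v' : comb n_ (col_mx v v') = (comb m_ v, comb m'_ v').
  rewrite /comb big_split_ord /=.
  have -> : \sum_i col_mx v v' (lshift mu' i) 0 *: n_ (lshift mu' i) =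
      (comb m_ v, 0).
    rewrite /comb; elim/big_rec2: _ => [|i x y _ ->] //.
    rewrite n_l col_mxEu; congr pair; rewrite /= ?scaler0 ?addr0 //.
  have -> : \sum_i col_mx v v' (rshift mu i) 0 *: n_ (rshift mu i) =
      (0, comb m'_ v').
    rewrite /comb; elim/big_rec2: _ => [|i x y _ ->] //.
    rewrite n_r col_mxEd; congr pair; rewrite /= ?scaler0 ?addr0 //.
  by congr pair; rewrite /= ?addr0 ?add0r.
exists n_; split; last by rewrite nE prod_subE st st'.
split=> [[m m']|v].
  have [v mv] := mS m; have [v' mv'] := mS' m'.
  by exists (col_mx v v'); rewrite nE prod_subE mv mv'.
rewrite -[v]vsubmxK nE prod_subE; split.
  move=> /andP[/mD[w ->] /mD'[w' ->]]; exists (col_mx w w').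
  by rewrite mul_block_col !mul0mx addr0 add0r.
move=> [w]; rewrite -[w]vsubmxK mul_block_col !mul0mx addr0 add0r.
move=> /eq_col_mx[-> ->]; apply/andP; split; [apply/mD | apply/mD'].
  by exists (usubmx w).
by exists (dsubmx w).
Qed.

End Sums.

(** * The topology *)

Section Topology.
Variables (G : ring_subcat) (MM : mod_class) (c : sub_op).

(** The module is forgotten, since a covering sees only the linear system. Membership of [R] in [G]
    is built in, which makes the definition meaningful for every ring. *)
Definition admissible_data (R : comPzRingType) (mu nu : nat)
    (D : 'M[R]_(mu, nu)) (t : 'cV[R]_mu) : Prop :=
  rc_ob G R /\ exists (M : lmodType R) (N : submodClosed M) (s : M),
    [/\ sub_in MM N, forcing_data D t N s & s \in c N].

Section Data.
Hypothesis MM_replete : replete G MM.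
Hypotheses (MM_sums : closed_under_sums G MM).
Hypotheses (MM_fp : consists_of_finitely_presented G MM).
Hypothesis c_admissible : admissible G MM c.

Lemma sub_in_forcing_data (R : comPzRingType) (M : lmodType R)
    (N : submodClosed M) :
  rc_ob G R -> sub_in MM N -> exists (mu nu : nat) (D : 'M[R]_(mu, nu)),
    forall s : M, exists t, forcing_data D t N s.
Proof.
by move=> GR [MM_M MM_N]; apply: forcing_data_exists; apply: MM_fp.
Qed.

Lemma admissible_data_cpure (R : comPzRingType) (mu nu : nat)
    (D : 'M[R]_(mu, nu)) (t : 'cV[R]_mu) :
  admissible_data D t -> cpure MM c (forcing_str D t).
Proof.
move=> [GR [M [N [s [MN Dt sN]]]]].
by case: c_admissible => _ pure_c _; apply: pure_c Dt sN.
Qed.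

(* Over the forcing algebra of [s] the image of [s] falls into the extension of
   [N], hence that of [f s] into the extension of [N'], and purity descends
   this to [R]. *)
Lemma closure_functorial (R : comPzRingType) (M M' : lmodType R)
    (N : submodClosed M) (N' : submodClosed M') (f : {linear M -> M'}) (s : M) :
  rc_ob G R -> sub_in MM N -> sub_in MM N' ->
  (forall n, n \in N -> f n \in N') -> s \in c N -> f s \in c N'.
Proof.
move=> GR MN MN' fN sN.
have [mu [nu [D /(_ s)[t Dt]]]] := sub_in_forcing_data GR MN.
have : cpure MM c (forcing_str D t).
  by apply: admissible_data_cpure; split=> //; exists M, N, s.
apply=> //; have [T [DT _]] := forcing_strP D t.
apply: (im_base_map (phi := forcing_str D t) (h := idfun) _ fN) => //.
exact: solution_im_base Dt DT.
Qed.

Section Pairs.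
Variables (R : comPzRingType) (M M' : lmodType R).

Definition pairl (x : M) : M * M' := (x, 0).
Definition pairr (x : M') : M * M' := (0, x).

Lemma pairl_linear : linear pairl.
Proof. by move=> a x y; congr pair; rewrite /= scaler0 addr0. Qed.
Lemma pairr_linear : linear pairr.
Proof. by move=> a x y; congr pair; rewrite /= scaler0 addr0. Qed.

HB.instance Definition _ :=
  GRing.isLinear.Build R M (M * M')%type *:%R pairl pairl_linear.
HB.instance Definition _ :=
  GRing.isLinear.Build R M' (M * M')%type *:%R pairr pairr_linear.
End Pairs.

Lemma admissible_data_sum (R : comPzRingType) (mu nu mu' nu' : nat)
    (D : 'M[R]_(mu, nu)) (t : 'cV[R]_mu) (D' : 'M[R]_(mu', nu'))
    (t' : 'cV[R]_mu') :
  admissible_data D t -> admissible_data D' t' ->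
  admissible_data (block_mx D 0 0 D') (col_mx t t').
Proof.
move=> [GR [M [N [s [MN Dt sN]]]]] [_ [M' [N' [s' [MN' Dt' sN']]]]].
split=> //; exists (M * M')%type, (prod_sub N N'), (s, s').
have MP : sub_in MM (prod_sub N N').
  split; first by apply: MM_sums => //; [case: MN | case: MN'].
  apply: (MM_replete (f := @prod_sub_of R M M' N N')) => //.
    exact: prod_sub_of_bij.
  by apply: MM_sums => //; [case: MN | case: MN'].
split=> //; first exact: forcing_data_sum.
(* Functoriality applies to the two inclusions separately; the closure is a submodule, so it
   contains the sum of the two images. *)
have -> : (s, s') = pairl M' s + pairr M s'.
  by congr pair; rewrite /= ?addr0 ?add0r.
apply: rpredD.
  apply: (closure_functorial GR MN) => // n nN.
  by rewrite prod_subE /= nN rpred0.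
apply: (closure_functorial GR MN') => // n nN.
by rewrite prod_subE /= nN rpred0.
Qed.

Lemma admissible_data_base (R S : comPzRingType) (phi : {rmorphism R -> S})
    (mu nu : nat) (D : 'M[R]_(mu, nu)) (t : 'cV[R]_mu) :
  rc_hom G phi -> admissible_data D t ->
  admissible_data (map_mx phi D) (map_mx phi t).
Proof.
move=> Gphi [GR [M [N [s [MN Dt sN]]]]]; split; first by case: (rc_hom_ob Gphi).
have [_ _ /(_ _ _ _ _ _ Gphi MN)[MN' cN']] := c_admissible.
exists (tens phi M), (im_base phi N), (pure phi s 1).
by split; [ | exact: forcing_data_base | exact: cN'].
Qed.

End Data.

(** * The site attached to one ring *)

Section Site.
Variable R : comPzRingType.
Implicit Types A B C P : alg R.

Definition site_ob A : Prop := finite_type (alg_str A).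

Definition site_hom A B (f : {rmorphism A -> B}) : Prop :=
  [/\ site_ob A, site_ob B & alg_hom f].

(* The case of isomorphisms matters only when no module over [R] is in [MM]. *)
Definition site_cov A B (f : {rmorphism A -> B}) : Prop :=
  site_hom f /\ (ring_iso f \/
    exists (mu nu : nat) (D : 'M[R]_(mu, nu)) (t : 'cV[R]_mu),
      admissible_data D t /\
      is_forcing f (map_mx (alg_str A) D) (map_mx (alg_str A) t)).

Lemma site_hom_id A (f : {rmorphism A -> A}) :
  site_ob A -> f =1 id -> site_hom f.
Proof. by move=> obA f1; split=> // r; apply: f1. Qed.

Lemma site_hom_comp A B C (f : {rmorphism A -> B}) (g : {rmorphism B -> C})
    (h : {rmorphism A -> C}) :
  site_hom f -> site_hom g -> h =1 g \o f -> site_hom h.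
Proof.
move=> [obA _ fR] [_ obC gR] hE; split=> // r.
by rewrite hE /= fR gR.
Qed.

Lemma site_ob_base : site_ob (base_alg R).
Proof. exact: finite_type_id. Qed.

Lemma site_finite_type A B (f : {rmorphism A -> B}) :
  site_hom f -> finite_type f.
Proof.
move=> [_ obB fR]; apply: finite_type_cancel obB => r; exact: esym (fR r).
Qed.

Section Fibre.
Variables (A B C P : alg R) (f : {rmorphism A -> B}) (g : {rmorphism A -> C}).
Variables (i : {rmorphism B -> P}) (j : {rmorphism C -> P}).
Hypotheses (hf : site_hom f) (hg : site_hom g) (hi : alg_hom i).
Hypothesis ij : is_pushout f g i j.

Lemma site_hom_fibre : site_hom i /\ site_hom j.
Proof.
have hj : alg_hom j.
  move=> r; have [_ _ gR] := hg; have [_ _ fR] := hf.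
  rewrite -gR -hi -fR; exact: esym (ij.1 (alg_str A r)).
have [obB obC] : site_ob B /\ site_ob C by case: hf; case: hg.
have obP : site_ob P.
  apply: (finite_type_comp (f := alg_str C) (g := j)) => // [r|].
    exact: esym (hj r).
  exact: finite_type_pushout ij (site_finite_type hf).
by [].
Qed.

Lemma site_cov_base : site_cov f -> site_cov j.
Proof.
move=> [_ cf]; split; first by case: site_hom_fibre.
case: cf => [fI|[mu [nu [D [t [aD fD]]]]]].
  by left; apply: ring_iso_pushout ij fI.
right; exists mu, nu, D, t; split=> //.
have gE m n (E : 'M[R]_(m, n)) :
    map_mx (alg_str C) E = map_mx g (map_mx (alg_str A) E).
  rewrite -map_mx_comp; apply: eq_map_mx => r.
  by have [_ _ /(_ r)] := hg.
by rewrite !gE; apply: forcing_base ij fD.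
Qed.

Lemma site_hom_mediating (E : alg R) (u : {rmorphism P -> E})
    (h : {rmorphism B -> E}) (k : {rmorphism C -> E}) :
  site_hom h -> site_hom k -> u \o i =1 h -> u \o j =1 k -> site_hom u.
Proof.
move=> [_ obE hR] _ ui _; have [[_ obP _] _] := site_hom_fibre.
by split=> // r; rewrite -hi [u _]ui.
Qed.

End Fibre.

Lemma site_cov_iso A B (f : {rmorphism A -> B}) (g : {rmorphism B -> A}) :
  site_hom f -> site_hom g -> cancel f g -> cancel g f -> site_cov f.
Proof. by move=> hf _ fg gf; split=> //; left; exists g. Qed.

Hypothesis MM_replete : replete G MM.
Hypotheses (MM_sums : closed_under_sums G MM).
Hypotheses (MM_fp : consists_of_finitely_presented G MM).
Hypothesis c_admissible : admissible G MM c.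

(** Since [D'] and [t'] are defined over [R], their images over [B] come from [A] by [fE]. This is
    what allows the two systems to be combined into one block system over [A]. *)
Lemma site_cov_comp A B C (f : {rmorphism A -> B}) (g : {rmorphism B -> C})
    (h : {rmorphism A -> C}) :
  site_cov f -> site_cov g -> h =1 g \o f -> site_cov h.
Proof.
move=> [hf cf] [hg cg] hE; split; first exact: site_hom_comp hf hg hE.
rewrite {hE}(rmorph_ext (g := g \o f) hE).
have fE m n (E : 'M[R]_(m, n)) :
    map_mx (alg_str B) E = map_mx f (map_mx (alg_str A) E).
  rewrite -map_mx_comp; apply: eq_map_mx => r.
  by have [_ _ /(_ r)] := hf.
case: cf => [fI|[mu [nu [D [t [aD fD]]]]]];
  case: cg => [gI|[mu' [nu' [D' [t' [aD' gD']]]]]].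
- by left; apply: ring_iso_comp.
- right; exists mu', nu', D', t'; split=> //.
  by apply: forcing_isol => //; rewrite -!fE.
- by right; exists mu, nu, D, t; split=> //; apply: forcing_isor.
- right; exists (mu + mu')%N, (nu + nu')%N, (block_mx D 0 0 D'), (col_mx t t').
  split; first exact: admissible_data_sum.
  rewrite map_block_mx map_col_mx !map_mx0.
  by apply: forcing_comp => //; rewrite -!fE.
Qed.

Definition forcing_topology : affine_topology R := {|
  hom_alg := fun A B (f : {rmorphism A -> B}) (hf : site_hom f) => hf;
  hom_id := site_hom_id;
  hom_comp := site_hom_comp;
  ob_base := site_ob_base;
  hom_fibre := site_hom_fibre;
  hom_mediating := fun A B C P E f g i j u h k hf hg hi ij =>
    @site_hom_mediating A B C P f g i j hf hg hi ij E u h k;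
  cov_hom := fun A B (f : {rmorphism A -> B}) (cf : site_cov f) => cf.1;
  cov_iso := site_cov_iso;
  cov_comp := site_cov_comp;
  cov_base := fun A B C P f g i j cf hg hi ij =>
    @site_cov_base A B C P f g i j cf.1 hg hi ij cf
|}.

Lemma forcing_topology_pushouts : has_cov_pushouts forcing_topology.
Proof.
move=> A B C f g [hf cf]; have hg : site_hom g := mor_hom g.
suff [P [i [j [obP hi ij]]]] : exists (P : alg R) (i : {rmorphism B -> P})
    (j : {rmorphism C -> P}), [/\ site_ob P, alg_hom i & is_pushout f g i j].
  have [hi' hj'] := site_hom_fibre hf hg hi ij.
  pose Pobj := @Obj R forcing_topology P obP.
  by exists Pobj, (@Mor _ _ B Pobj i hi'), (@Mor _ _ C Pobj j hj').
have [_ obC gR] := hg; have [_ _ fR] := hf.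
case: cf => [[f' [ff' f'f]]|[mu [nu [D [t [_ fD]]]]]].
  exists C, (g \o f'), idfun; split=> // [r|]; last exact: pushout_of_iso.
  by rewrite -fR /= ff' gR.
pose j := forcing_str (map_mx (alg_str C) D) (map_mx (alg_str C) t).
have gE m n (E : 'M[R]_(m, n)) :
    map_mx (alg_str C) E = map_mx g (map_mx (alg_str A) E).
  rewrite -map_mx_comp; apply: eq_map_mx => r.
  exact: esym (gR r).
have [|i ij] := forcing_pushout (g := g) (j := j) fD.
  by rewrite -!gE; apply: forcing_strP.
exists (Alg (j \o alg_str C)), i, j; split=> //.
  exact: finite_type_comp obC (finite_type_palg _).
by move=> r; rewrite -fR [LHS]ij.1 /= gR.
Qed.

Lemma forcing_topology_single_handed : single_handed forcing_topology.
Proof. by move=> A B f; apply: site_finite_type. Qed.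

Lemma forcing_topology_closure (M : lmodType R) (N : submodClosed M) (s : M) :
  rc_ob G R -> sub_in MM N ->
  top_closure forcing_topology N s <-> s \in c N.
Proof.
move=> GR MN; apply: (iff_trans (top_closureP forcing_topology_pushouts N s)).
have [mu [nu [D Dt]]] := sub_in_forcing_data MM_fp GR MN.
split=> [[A [f [[hf cf] sA]]]|sN].
  (* It suffices to map [A] over [R] to a forcing algebra of admissible data: membership of [s] in
     the extension of [N] passes along [u], and c-purity of the target descends it to [R]. *)
  suff [mu' [nu' [D' [t' [aD' [u uf]]]]]] :
      exists (mu' nu' : nat) (D' : 'M[R]_(mu', nu')) (t' : 'cV[R]_mu'),
        admissible_data D' t' /\
        exists u : {rmorphism A -> forcing_alg D' t'},
          u \o alg_str A =1 forcing_str D' t'.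
    apply: (admissible_data_cpure c_admissible aD') => //.
    by apply: (im_base_map (f := idfun) uf _ sA).
  have [_ _ fR] := hf.
  case: cf => [[f' [ff' _]]|[mu' [nu' [D' [t' [aD' fD']]]]]].
    (* An isomorphism carries no data, so the element 0, which lies in every closure, supplies
       some. *)
    have [t D0] := Dt 0; exists mu, nu, D, t; split.
      by split=> //; exists M, N, 0; split=> //; apply: rpred0.
    exists (forcing_str D t \o f') => r /=.
    by rewrite -[alg_str A r]fR ff'.
  exists mu', nu', D', t'; split=> //.
  (* The covering starts at the base object, whose structure map is the identity, so [A] represents
     the solutions of D' T = t' itself. The tautological solution in [forcing_alg D' t'] gives
     [u]. *)
  have [T [_ TU]] := fD'; have [T' [DT' _]] := forcing_strP D' t'.
  have [|u [uf _ _]] := TU _ (forcing_str D' t') T'.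
    by rewrite !map_mx_id.
  by exists u => r; rewrite /= -[alg_str A r]fR; apply: uf.
have [t Dts] := Dt s; have [T [DT _]] := forcing_strP D t.
pose A := Alg (forcing_str D t).
have hA : site_hom (A := base_alg R) (B := A) (forcing_str D t).
  by split=> //; [exact: site_ob_base | exact: finite_type_palg].
have obA : site_ob A by case: hA.
pose Aobj := @Obj R forcing_topology A obA.
exists Aobj, (@Mor _ _ (base_obj _) Aobj _ hA).
split; last exact: solution_im_base Dts DT.
split=> //; right; exists mu, nu, D, t; split.
  by split=> //; exists M, N, s.
by rewrite !map_mx_id //; apply: forcing_strP.
Qed.

End Site.

Section SiteMorphism.
Variables (R S : comPzRingType) (phi : {rmorphism R -> S}).

Section SiteBase.
Variables (A B : alg R) (A' B' : alg S).
Variables (a : {rmorphism A -> A'}) (b : {rmorphism B -> B'}).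
Variables (f : {rmorphism A -> B}) (f' : {rmorphism A' -> B'}).
Hypothesis Pa : is_pushout phi (alg_str A) (alg_str A') a.

Lemma site_ob_pushout : site_ob A -> site_ob A'.
Proof. by move=> obA; apply: finite_type_pushout (is_pushoutC Pa) obA. Qed.

Hypothesis Pb : is_pushout phi (alg_str B) (alg_str B') b.
Hypotheses (hf' : alg_hom f') (ff' : f' \o a =1 b \o f).

(** By pasting, [f'] is the base change of [f] along [a], and the system over [A'] is the one over
    [R] transported first along [phi]. Transport of admissibility is left as a premise; persistence
    supplies it when [phi] is in [G]. *)
Lemma site_cov_pushout :
  (forall (mu nu : nat) (D : 'M[R]_(mu, nu)) (t : 'cV[R]_mu),
     admissible_data D t -> admissible_data (map_mx phi D) (map_mx phi t)) ->
  site_hom f' -> site_cov f -> site_cov f'.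
Proof.
move=> adm_phi hf'' [[_ _ fR] cf]; split=> //.
have Pf : is_pushout f a b f' by apply: pushout_paste Pa Pb _ _ ff'.
case: cf => [fI|[mu [nu [D [t [aD fD]]]]]].
  by left; apply: ring_iso_pushout Pf fI.
right; exists mu, nu, (map_mx phi D), (map_mx phi t).
split; first exact: adm_phi.
have aE m n (E : 'M[R]_(m, n)) :
    map_mx (alg_str A') (map_mx phi E) = map_mx a (map_mx (alg_str A) E).
  by rewrite -!map_mx_comp; apply: eq_map_mx; apply: Pa.1.
by rewrite !aE; apply: forcing_base Pf fD.
Qed.

End SiteBase.
End SiteMorphism.

End Topology.

Theorem theorem2p6p1 (G : ring_subcat) (MM : mod_class) (c : sub_op)
    (G_forcing : closed_under_forcing G)
    (MM_base : base_change_stable G MM)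
    (MM_replete : replete G MM)
    (MM_sums : closed_under_sums G MM)
    (MM_fp : consists_of_finitely_presented G MM)
    (c_admissible : admissible G MM c) :
  exists top : forall R : comPzRingType, affine_topology R,
    (forall R : comPzRingType, rc_ob G R ->
       single_handed (top R) /\
       forall (M : lmodType R) (N : submodClosed M), sub_in MM N ->
         forall s : M, top_closure (top R) N s <-> s \in c R M N) /\
    (forall (R S : comPzRingType) (phi : {rmorphism R -> S}),
       rc_hom G phi -> site_morphism phi (top R) (top S)).
Proof.
(* The construction makes sense for all rings: outside [G] there are no admissible data, and only
   isomorphisms cover. *)
exists (fun R => forcing_topology R MM_replete MM_sums MM_fp c_admissible).
split=> [R GR|R S phi Gphi].
  split=> [|M N MN s]; first exact: forcing_topology_single_handed.
  exact: forcing_topology_closure.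
split=> [A A' a obA Pa|A B A' B' a b f f' Pa Pb hf' ff'].
  exact: site_ob_pushout Pa obA.
have homf' : site_hom f -> site_hom f'.
  move=> [obA obB _]; split=> //.
    exact: site_ob_pushout Pa obA.
  exact: site_ob_pushout Pb obB.
split=> // cf; have [hf _] := cf.
apply: (site_cov_pushout Pa Pb hf' ff') (homf' hf) cf => mu nu D t.
exact: admissible_data_base.
Qed.
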